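(* For any fixed odd $q$, and for each choice of sign (the same sign in numerator and denominator), we have $$\lim_{n\to\infty}\frac{i(\Omega^{\pm}(n,q))}{i(\mathrm{SO}^{\pm}(n,q))}=\frac12,$$ where $n$ runs over all positive integers, even and odd.
   Context: For $q$ an odd prime power and $\delta$ a fixed nonsquare in $\mathbb{F}_q^{\times}$: $\mathrm{O}^{+}(2k,q)$ is the isometry group on $\mathbb{F}_q^{2k}$ of the quadratic form $x_1x_2+x_3x_4+\cdots+x_{2k-1}x_{2k}$; $\mathrm{O}^{-}(2k,q)$ is that of $x_1x_2+\cdots+x_{2k-3}x_{2k-2}+x_{2k-1}^2-\delta x_{2k}^2$; $\mathrm{O}^{+}(2k+1,q)$ and $\mathrm{O}^{-}(2k+1,q)$ are the (isomorphic) isometry groups on $\mathbb{F}_q^{2k+1}$ of $x_1x_2+\cdots+x_{2k-1}x_{2k}+x_{2k+1}^2$ and $x_1x_2+\cdots+x_{2k-1}x_{2k}+\delta x_{2k+1}^2$ respectively. $\mathrm{SO}^{\pm}(n,q)$ is the subgroup of determinant $1$ elements of $\mathrm{O}^{\pm}(n,q)$, and $\Omega^{\pm}(n,q)$ is the derived subgroup of $\mathrm{SO}^{\pm}(n,q)$ (of index $2$ in it for $n\ge 3$). $i(X)$ denotes the number of $g\in X$ with $g^2=1$ (the identity is counted). *)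

(* Defs.v *)
From HB Require Import structures.
From mathcomp Require Import all_boot all_order all_algebra all_fingroup all_solvable.
From mathcomp Require Import reals topology normedtype sequences.

Set Implicit Arguments.
Unset Strict Implicit.
Unset Printing Implicit Defensive.

Import Order.TTheory GRing.Theory Num.Theory.

Local Open Scope ring_scope.

Variant orth_sign := Plus | Minus.

(* Dimensions are written n.+1, so that they are positive and so that
   {'GL_n.+1[F]} consists of n.+1 by n.+1 matrices; the 1-based coordinate
   x_j of the text is [x (inord j.-1) 0]. *)
Definition quad_form (F : finFieldType) (delta : F) (s : orth_sign) (n : nat)
    (x : 'cV[F]_n.+1) : F :=
  let c (j : nat) : F := x (inord j) 0 in
  let hyperbolic (k : nat) : F := \sum_(i < k) c i.*2 * c i.*2.+1 in
  if odd n.+1 then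
    hyperbolic n.+1./2 +
      match s with Plus => c n ^+ 2 | Minus => delta * c n ^+ 2 end
  else
    match s with
    | Plus => hyperbolic n.+1./2
    | Minus => hyperbolic n.+1./2.-1 + (c n.-1 ^+ 2 - delta * c n ^+ 2)
    end.

Definition orthogonal_set (F : finFieldType) (delta : F) (s : orth_sign)
    (n : nat) : {set {'GL_n.+1[F]}} :=
  [set g : {'GL_n.+1[F]} |
    [forall x : 'cV[F]_n.+1,
      quad_form delta s (GLval g *m x) == quad_form delta s x]].

Lemma orthogonal_group_set (F : finFieldType) (delta : F) (s : orth_sign)
    (n : nat) : group_set (orthogonal_set delta s n).
Proof.
apply/group_setP; split.
  by rewrite inE; apply/forallP => x; rewrite GL_1E mul1mx.
move=> g h; rewrite !inE => /forallP Hg /forallP Hh; apply/forallP => x.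
by rewrite GL_MxE -mulmxA (eqP (Hg _)).
Qed.

Canonical orthogonal_group (F : finFieldType) (delta : F) (s : orth_sign)
    (n : nat) : {group {'GL_n.+1[F]}} :=
  Group (orthogonal_group_set delta s n).

Definition special_orthogonal_set (F : finFieldType) (delta : F)
    (s : orth_sign) (n : nat) : {set {'GL_n.+1[F]}} :=
  [set g in orthogonal_set delta s n | \det (GLval g) == 1].

Lemma special_orthogonal_group_set (F : finFieldType) (delta : F)
    (s : orth_sign) (n : nat) : group_set (special_orthogonal_set delta s n).
Proof.
apply/group_setP; split.
  by rewrite inE group1 GL_1E det1 eqxx.
move=> g h; rewrite inE => /andP[Og /eqP dg]; rewrite inE => /andP[Oh /eqP dh].
rewrite inE; apply/andP; split; first exact: groupM.
by rewrite GL_MxE det_mulmx dg dh mulr1.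
Qed.

Canonical special_orthogonal_group (F : finFieldType) (delta : F)
    (s : orth_sign) (n : nat) : {group {'GL_n.+1[F]}} :=
  Group (special_orthogonal_group_set delta s n).

Definition Omega_group (F : finFieldType) (delta : F) (s : orth_sign)
    (n : nat) : {group {'GL_n.+1[F]}} :=
  ((special_orthogonal_group delta s n)^`(1))%G.

(* The identity is counted. *)
Definition num_involutions (gT : finGroupType) (X : {set gT}) : nat :=
  #|[set g in X | (g ^+ 2 == 1)%g]|.

(* Main.v *)
Require Import Defs.
From HB Require Import structures.
From mathcomp Require Import all_boot all_order all_algebra all_fingroup all_solvable.
From mathcomp Require Import reals topology normedtype sequences.
From mathcomp Require Import ring lra zify.

(* An involution t of SO is determined by the orthogonal decomposition
   V = V+ (+) V- into its eigenspaces, dim V- being even.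

   The parity of the permutation that an isometry induces on the sphere
   {x | Q x = 1} is a character of the orthogonal group, trivial on Omega. It
   takes different values at the reflections r_a, r_b when a and b are
   orthogonal with Q a = 1 and Q b = delta: the numbers of unit vectors of
   a^perp and of b^perp add up to 2 |W|, where W = <a, b>^perp has odd
   cardinality, whereas the number of unit vectors of V is even. Conversely
   r_v r_w is a commutator of elements of SO when v and w are orthogonal with
   Q v = Q w; diagonalizing Q on V- into values 1 and delta, the involutions of
   Omega are therefore exactly those on which the character is trivial.

   For a in V+ and b in V- with {Q a, Q b} = {1, delta}, the map
   (t, a, b) |-> (t r_a r_b, b, a) is an involution that flips the character.
   Hence the sum over t of chi(t) f(t) vanishes, where f(t) is the number of such
   pairs (a, b). A second moment computation shows that Q is nearly
   equidistributed on V+ and V-, so that f(t) is close to 2 |V| / q^2 as soon as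
   V+ and V- are both large; the remaining t are negligible, by double counting
   with (t, a) |-> (t r_a, a). So chi has mean tending to 0. *)

Set Implicit Arguments.
Unset Strict Implicit.
Unset Printing Implicit Defensive.

Import Order.TTheory GRing.Theory Num.Theory.
Import numFieldNormedType.Exports.

Local Open Scope ring_scope.

(** * Involutive permutations, bilinear forms *)

(** Induction on the number of moved points: composing with [tperm x (s x)] makes [x] and [s x]
    fixed, so one disjoint transposition is peeled off and the parity changes. *)
Lemma odd_perm_involution (T : finType) (s : {perm T}) :
    (forall x, s (s x) = x) ->
  exists2 k, #|[set x | s x != x]| = k.*2 & odd_perm s = odd k.
Proof.
have [m] := ubnP #|[set x | s x != x]|; elim: m s => // m IHm s + sK.
have [x sx | s1 _] := pickP (fun x => s x != x); last first.
  exists 0%N; first by apply: eq_card0 => x; rewrite inE s1.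
  suff ->: s = 1%g by rewrite odd_perm1.
  by apply/permP => x; rewrite perm1; apply/eqP; rewrite -[_ == _]negbK s1.
set s' := (tperm x (s x) * s)%g.
have s'E y : s' y = if (y == x) || (y == s x) then y else s y.
  rewrite permM; case: tpermP => [->|->|/eqP/negPf-> /eqP/negPf-> //].
    by rewrite eqxx.
  by rewrite eqxx orbT.
have moved : [set y | s y != y] = x |: (s x |: [set y | s' y != y]).
  apply/setP => y; rewrite !inE s'E.
  case: (y =P x) => [->|_] //=; case: (y =P s x) => [->|_] //=.
  by rewrite sK eq_sym.
have cmoved : #|[set y | s y != y]| = #|[set y | s' y != y]|.+2.
  by rewrite moved !cardsU1 !inE !s'E !eqxx orbT /= !eqxx eq_sym (negPf sx).
rewrite cmoved ltnS => /ltnW lem.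
have [|k ck ok] := IHm s' lem.
  move=> y; rewrite [s' y]s'E; case: ifP => yx; first by rewrite s'E yx.
  by rewrite s'E (can2_eq sK sK) orbC (inj_eq perm_inj) yx sK.
exists k.+1; first by rewrite ck doubleS.
by rewrite /= -ok odd_permM odd_tperm eq_sym sx addTb negbK.
Qed.

(** Extended by the identity outside [S], [f] becomes an involutive permutation whose moved points
    are exactly [S]. *)
Lemma odd_card_fixedfree (T : finType) (f : T -> T) (S : {set T}) :
    {in S, forall x, [/\ f x \in S, f (f x) = x & f x != x]} ->
  ~~ odd #|S|.
Proof.
move=> fS; pose g x := if x \in S then f x else x.
have gK : involutive g.
  move=> x; rewrite /g; case: (boolP (x \in S)) => xS; last by rewrite (negPf xS).
  by have [-> -> _] := fS x xS.
have [x|k] := @odd_perm_involution _ (perm (inv_inj gK)); first by rewrite !permE.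
suff -> : [set x | perm (inv_inj gK) x != x] = S by move=> -> _; rewrite odd_double.
apply/setP => x; rewrite inE permE /g; case: ifP => [xS|]; last by rewrite eqxx.
by have [_ _ ->] := fS x xS.
Qed.

Lemma two_neq0_odd_card (F : finFieldType) : odd #|F| -> 2%:R != 0 :> F.
Proof.
apply: contraL => /eqP two0; rewrite -cardsT.
(* If 2 vanished, translation by 1 would be an involution of [F] without fixed points. *)
apply: (@odd_card_fixedfree _ (fun x => x + 1)) => x _.
rewrite in_setT -addrA -[1 + 1]/(2%:R) two0 addr0; split=> //.
by rewrite addrC -subr_eq0 addrK oner_eq0.
Qed.

Section BilinearForm.

Variables (F : finFieldType) (n : nat) (A : 'M[F]_n.+1).
Hypotheses (two_neq0 : 2%:R != 0 :> F) (symA : A^T = A) (unitA : A \in unitmx).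

Local Notation V := 'cV[F]_n.+1.
Implicit Types (x y u v w a b : V) (c k : F).

Definition bil x y : F := (x^T *m A *m y) 0 0.
Local Notation Q x := (bil x x).

Lemma bilC x y : bil x y = bil y x.
Proof. by rewrite /bil -[x^T *m A *m y]trmxK mxE !trmx_mul trmxK symA mulmxA. Qed.

Lemma bilDl x y u : bil (x + y) u = bil x u + bil y u.
Proof. by rewrite /bil linearD !mulmxDl mxE. Qed.

Lemma bilZl c x u : bil (c *: x) u = c * bil x u.
Proof. by rewrite /bil linearZ -!scalemxAl mxE. Qed.

Lemma bilDr x y u : bil u (x + y) = bil u x + bil u y.
Proof. by rewrite !(bilC u) bilDl. Qed.

Lemma bilZr c x u : bil u (c *: x) = c * bil u x.
Proof. by rewrite !(bilC u) bilZl. Qed.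

Lemma bilNl x u : bil (- x) u = - bil x u.
Proof. by rewrite -scaleN1r bilZl mulN1r. Qed.

Lemma bilNr x u : bil u (- x) = - bil u x.
Proof. by rewrite !(bilC u) bilNl. Qed.

Lemma bil0l u : bil 0 u = 0.
Proof. by rewrite -(scale0r u) bilZl mul0r. Qed.

Lemma bil0r u : bil u 0 = 0.
Proof. by rewrite bilC bil0l. Qed.

Definition bilE := (bilDl, bilDr, bilNl, bilNr, bilZl, bilZr).

Lemma bil_nondegenerate x : x != 0 -> exists y, bil x y != 0.
Proof.
move=> x_neq0; apply/existsP; rewrite -[X in is_true X]negbK negb_exists.
apply: contraNN x_neq0 => /forallP xB; apply/eqP.
have x0 y : bil x y = 0 by apply/eqP; rewrite -[_ == _]negbK xB.
suff: x^T *m A = 0.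
  move/(congr1 (mulmx^~ (invmx A))); rewrite mulmxK // mul0mx => xT0.
  by rewrite -[x]trmxK xT0 trmx0.
apply/rowP => j; rewrite [RHS]mxE -(x0 (delta_mx j 0)) /bil.
by rewrite -colE [RHS]mxE.
Qed.

Lemma polarization x y : bil x y *+ 2 = Q (x + y) - Q x - Q y.
Proof. by rewrite !bilE (bilC y x); ring. Qed.

(** The groups of the statement for a form given by a matrix, so that the argument is uniform in the
    sign and in the parity of the dimension. *)
Definition form_isometries : {set {'GL_n.+1[F]}} :=
  [set g : {'GL_n.+1[F]} | [forall x : V, Q (GLval g *m x) == Q x]].

Lemma form_isometriesP (g : {'GL_n.+1[F]}) :
  reflect (forall x y, bil (GLval g *m x) (GLval g *m y) = bil x y)
    (g \in form_isometries).
Proof.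
rewrite inE; apply: (iffP forallP) => [gQ x y | gB x]; last by rewrite gB.
apply: (mulIf two_neq0); rewrite !mulr_natr !polarization -mulmxDr.
by rewrite !(eqP (gQ _)).
Qed.

Lemma form_isometriesM (g h : {'GL_n.+1[F]}) :
  g \in form_isometries -> h \in form_isometries -> (g * h)%g \in form_isometries.
Proof.
rewrite !inE => /forallP gQ /forallP hQ; apply/forallP => x.
by rewrite GL_MxE -mulmxA (eqP (gQ _)).
Qed.

Lemma form_isometries_group_set : group_set form_isometries.
Proof.
apply/group_setP; split=> [|g h]; last exact: form_isometriesM.
by rewrite inE; apply/forallP => x; rewrite GL_1E mul1mx.
Qed.

Canonical form_isometries_group := Group form_isometries_group_set.

Definition special_form_isometries : {set {'GL_n.+1[F]}} :=
  [set g in form_isometries | \det (GLval g) == 1].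

Lemma special_form_isometries_group_set : group_set special_form_isometries.
Proof.
apply/group_setP; split.
  by rewrite inE group1 GL_1E det1 eqxx.
move=> g h; rewrite inE => /andP[Og /eqP dg]; rewrite inE => /andP[Oh /eqP dh].
rewrite inE; apply/andP; split; first exact: groupM.
by rewrite GL_MxE det_mulmx dg dh mulr1.
Qed.

Canonical special_form_isometries_group := Group special_form_isometries_group_set.

End BilinearForm.

(** * Reflections and the sphere character *)

(** Multiplied in the two orders, the block matrices [M] and [L] give block triangular matrices
    whose determinants are the two sides. *)
Lemma det_1_sub_rank1 (R : comNzRingType) (n : nat) (u : 'cV[R]_n) (v : 'rV[R]_n) :
  \det (1%:M - u *m v) = 1 - (v *m u) 0 0.
Proof.
pose L : 'M_(n + 1) := block_mx 1%:M 0 (- v) 1%:M.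
pose M : 'M_(n + 1) := block_mx 1%:M u v 1%:M.
have detL : \det L = 1 by rewrite det_lblock !det1 mulr1.
have ML : M *m L = block_mx (1%:M - u *m v) u 0 1%:M.
  by rewrite mulmx_block !mul1mx !mulmx1 !mulmx0 mulmxN !add0r subrr.
have LM : L *m M = block_mx 1%:M u 0 (1%:M - v *m u).
  by rewrite mulmx_block !mul1mx !mulmx1 !mul0mx !addr0 mulNmx addNr [- _ + _]addrC.
have := congr1 determinant LM; rewrite det_mulmx mulrC -det_mulmx ML.
by rewrite !det_ublock !det1 mulr1 mul1r det_mx11 !mxE eqxx.
Qed.

Local Notation "g *v x" := (GLval g *m x) (at level 40, left associativity).

Lemma GL_eqP (F : finFieldType) (n : nat) (g h : {'GL_n.+1[F]}) :
  (forall x : 'cV_n.+1, g *v x = h *v x) <-> g = h.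
Proof.
split=> [gh|-> //]; apply/val_inj/matrixP => i j.
by have /matrixP/(_ i 0) := gh (delta_mx j 0); rewrite -!colE !mxE.
Qed.

Lemma GL_actM (F : finFieldType) (n : nat) (g h : {'GL_n.+1[F]}) (x : 'cV_n.+1) :
  (g * h)%g *v x = g *v (h *v x).
Proof. by rewrite GL_MxE mulmxA. Qed.

Lemma GL_act1 (F : finFieldType) (n : nat) (x : 'cV[F]_n.+1) :
  (1%g : {'GL_n.+1[F]}) *v x = x.
Proof. by rewrite GL_1E mul1mx. Qed.

(** * Words in commuting involutions of an abstract group *)

Section CommutingInvolutions.

Variables (gT : groupType).
Implicit Types (s t a b v w : gT).
Local Open Scope group_scope.

Lemma invg_involution a : a * a = 1 -> a^-1 = a.
Proof. by move=> aa; rewrite -[LHS]mulg1 -aa mulgA mulVg mul1g. Qed.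

Lemma mulg_involutions a b : commute a b -> a * a = 1 -> b * b = 1 ->
  a * b * (a * b) = 1.
Proof. by move=> ab aa bb; rewrite {1}ab -mulgA (mulgA a) aa mul1g bb. Qed.

Lemma mulgK_involution t a : a * a = 1 -> t * a * a = t.
Proof. by move=> aa; rewrite -mulgA aa mulg1. Qed.

Lemma mulgK_involutions t a b : a * a = 1 -> b * b = 1 -> t * a * b * (b * a) = t.
Proof. by move=> aa bb; rewrite -!mulgA (mulgA b) bb mul1g aa mulg1. Qed.

Lemma mulgK_involutions2 t a b : a * a = 1 -> b * b = 1 -> t * a * b * b * a = t.
Proof. by move=> aa bb; rewrite (mulgK_involution _ bb) (mulgK_involution _ aa). Qed.

Lemma mulg_commute_pairs t a b v w :
    commute a v -> commute a w -> commute b v -> commute b w ->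
  t * (b * a) * (v * w) = t * (v * w) * (b * a).
Proof.
move=> av aw bv bw; have cv : commute (b * a) v.
  exact: commute_sym (commuteM (commute_sym bv) (commute_sym av)).
have cw : commute (b * a) w.
  exact: commute_sym (commuteM (commute_sym bw) (commute_sym aw)).
by rewrite -!(mulgA t) (commuteM cv cw).
Qed.

Lemma mulg_insert_involution t s a : s * s = 1 -> t * s * (s * a) = t * a.
Proof. by move=> ss; rewrite mulgA -(mulgA t) ss mulg1. Qed.

Lemma mulg_shuffle1 a b v w : commute a w -> commute a b ->
  v * w * (b * a) = v * a * (w * b).
Proof. by move=> aw ab; rewrite -!mulgA (commuteM aw ab) -(mulgA w). Qed.

Lemma mulg_shuffle2 a b v w : commute w b -> v * w * (b * a) = v * b * (w * a).
Proof. by move=> wb; rewrite -!mulgA (mulgA w) wb -mulgA. Qed.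

End CommutingInvolutions.

Section Reflections.

Variables (F : finFieldType) (n : nat) (A : 'M[F]_n.+1).
Hypotheses (two_neq0 : 2%:R != 0 :> F) (symA : A^T = A).

Local Notation V := 'cV[F]_n.+1.
Local Notation GL := {'GL_n.+1[F]}.
Local Notation B := (bil A).
Local Notation Q x := (bil A x x).
Local Notation O := (form_isometries A).
Implicit Types (x y u v w a b : V) (c k : F) (g h : GL).

Definition refl_mx a : 'M[F]_n.+1 :=
  1%:M - (2%:R / Q a) *: a *m (a^T *m A).

Lemma refl_mxE a x : refl_mx a *m x = x - (2%:R / Q a * B a x) *: a.
Proof.
rewrite /refl_mx mulmxBl mul1mx -mulmxA [_ *m A *m x]mx11_scalar mul_mx_scalar.
by rewrite scalerA mulrC.
Qed.

Lemma refl_mxK a : refl_mx a *m refl_mx a = 1%:M.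
Proof.
suff rK x : refl_mx a *m (refl_mx a *m x) = x.
  apply/matrixP => i j; have /matrixP/(_ i 0) := rK (delta_mx j 0).
  by rewrite mulmxA -colE !mxE eqxx andbT.
rewrite !refl_mxE !(bilE symA); have [->|Qa] := eqVneq (Q a) 0.
  by rewrite invr0 !mulr0 !mul0r !scale0r !subr0.
rewrite -addrA -scaleNr -scaleNr -scalerDl -[RHS]addr0; congr (_ + _).
by rewrite -[RHS](scale0r a); congr (_ *: _); field.
Qed.

(* For isotropic [a] this is the identity, since [2 / 0 = 0]. *)
Definition refl a : GL := insubd (1%g : GL) (refl_mx a).

Lemma val_refl a : GLval (refl a) = refl_mx a.
Proof. by apply: insubdK; case: (mulmx1_unit (refl_mxK a)). Qed.

Lemma reflE a x : refl a *v x = x - (2%:R / Q a * B a x) *: a.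
Proof. by rewrite val_refl refl_mxE. Qed.

Lemma refl_mulgg a : (refl a * refl a = 1)%g.
Proof. by apply: val_inj; rewrite [LHS]GL_MxE val_refl refl_mxK. Qed.

Lemma refl_inv a : ((refl a)^-1 = refl a)%g.
Proof. exact: invg_involution (refl_mulgg a). Qed.

Lemma refl_isometry a : refl a \in O.
Proof.
rewrite inE; apply/forallP => x; apply/eqP; rewrite !reflE !(bilE symA).
have [->|Qa] := eqVneq (Q a) 0.
  by rewrite invr0; ring.
by rewrite [B x a](bilC symA); field.
Qed.

Lemma det_refl a : Q a != 0 -> \det (GLval (refl a)) = -1.
Proof.
move=> Qa; rewrite val_refl /refl_mx det_1_sub_rank1.
by rewrite -scalemxAr mxE -[_ 0 0]/(Q a); field.
Qed.

Lemma refl_fix a x : B a x = 0 -> refl a *v x = x.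
Proof. by rewrite reflE => ->; rewrite mulr0 scale0r subr0. Qed.

Lemma refl_fixE a x : Q a != 0 -> (refl a *v x == x) = (B a x == 0).
Proof.
move=> Qa; apply/eqP/eqP => [|/refl_fix //].
rewrite reflE => /(congr1 (B a)); rewrite !(bilE symA) => Bx.
have /eqP : 2%:R * B a x = 0 by rewrite -[RHS](subrr (B a x)) -{3}Bx; field.
by rewrite mulf_eq0 (negPf two_neq0) => /eqP.
Qed.

Lemma refl_self a : Q a != 0 -> refl a *v a = - a.
Proof.
move=> Qa; rewrite reflE divfK // scaler_nat opprD addrA subrr.
by rewrite add0r.
Qed.

Lemma reflZ c a : c != 0 -> refl (c *: a) = refl a.
Proof.
move=> c0; apply/GL_eqP => x; rewrite !reflE !(bilE symA) scalerA.
have [->|Qa] := eqVneq (Q a) 0; first by rewrite !mulr0 invr0 !mulr0 !mul0r.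
by congr (_ - _ *: _); field; rewrite Qa c0.
Qed.

(** Since [x ^ y] is [y^-1 * x * y], the left side is [g * refl a * g^-1]; an isometry transports
    the formula for the reflection. *)
Lemma refl_conj g a : g \in O -> (refl a ^ g^-1)%g = refl (g *v a).
Proof.
move=> /(form_isometriesP two_neq0 symA) gB; apply/GL_eqP => x.
rewrite conjgE invgK !GL_actM reflE [in RHS]reflE gB mulmxBr -scalemxAr.
by rewrite -(gB a (g^-1%g *v x)) -GL_actM mulgV GL_act1.
Qed.

Lemma refl_commute a b : B a b = 0 -> commute (refl a) (refl b).
Proof.
move=> ab; apply/GL_eqP => x; rewrite !GL_actM !reflE !(bilE symA).
by rewrite ab (bilC symA b a) ab !mulr0 !subr0 addrAC.
Qed.

Definition sphere : {set V} := [set x | Q x == 1].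

(** Made the identity off the sphere and for [g] outside [O], so that it is injective on the whole
    space for every [g] and yields a permutation. *)
Definition sphere_map g x := if (g \in O) && (x \in sphere) then g *v x else x.

Lemma sphere_map_inj g : injective (sphere_map g).
Proof.
have gS x : g \in O -> (g *v x \in sphere) = (x \in sphere).
  by rewrite !inE => /forallP/(_ x)/eqP->.
rewrite /sphere_map; case: (boolP (g \in O)) => /= gO x y //.
have gI : injective (fun x : V => g *v x).
  move=> u v /(congr1 (fun w => g^-1%g *v w)).
  by rewrite -!GL_actM mulVg !GL_act1.
case: ifP => xS; case: ifP => yS //; first by move/gI.
  by move=> xy; rewrite -xy gS // xS in yS.
by move=> xy; rewrite xy gS // yS in xS.
Qed.

(* Up to a character common to all reflections, this is the spinor norm. *)
Definition spin g : bool := perm (@sphere_map_inj g).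

Lemma spinM : {in O &, forall g h, spin (g * h)%g = spin g (+) spin h}.
Proof.
move=> g h gO hO; rewrite addbC -odd_permM; congr odd_perm.
apply/permP => x; rewrite permM !permE /sphere_map gO hO (groupM gO hO) !andTb.
case: (boolP (x \in sphere)) => xS; last by rewrite (negPf xS).
suff -> : h *v x \in sphere by rewrite GL_actM.
by move: hO xS; rewrite !inE => /forallP/(_ x)/eqP->.
Qed.

Lemma spin_involution g : g \in O -> (g * g = 1)%g ->
  exists2 k, #|[set x in sphere | g *v x != x]| = k.*2 & spin g = odd k.
Proof.
move=> gO gg; have [x|k ck ok] := @odd_perm_involution _ (perm (@sphere_map_inj g)).
  rewrite -permM -[RHS]perm1; congr (fun_of_perm _ x); apply/permP => y.
  rewrite permM perm1 !permE /sphere_map gO /=.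
  case: (boolP (y \in sphere)) => yS; last by rewrite (negPf yS).
  rewrite -GL_actM gg GL_act1; case: ifP => // /negP[].
  by move: gO yS; rewrite !inE => /forallP/(_ y)/eqP->.
exists k => //; rewrite -ck; apply: eq_card => x; rewrite !inE permE /sphere_map.
by rewrite gO inE /=; case: ifP => // _; rewrite eqxx.
Qed.

End Reflections.

(** * The sphere character at reflections, by counting unit vectors *)

Section SpinOfReflections.

Variables (F : finFieldType) (n : nat) (A : 'M[F]_n.+1) (delta : F).
Hypotheses (two_neq0 : 2%:R != 0 :> F) (symA : A^T = A).
Hypothesis delta_nonsquare : forall c : F, c ^+ 2 != delta.

Local Notation V := 'cV[F]_n.+1.
Local Notation GL := {'GL_n.+1[F]}.
Local Notation B := (bil A).
Local Notation Q x := (bil A x x).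
Local Notation O := (form_isometries A).
Local Notation SO := (special_form_isometries A).
Implicit Types (x y u v w a b : V) (c k : F) (g h t : GL).

Lemma nonsquare_neq0 : delta != 0.
Proof. by apply: contraNneq (delta_nonsquare 0) => ->; rewrite expr0n. Qed.

Definition sqr_sol (k c : F) : {set F} := [set y : F | k * y ^+ 2 == c].
Arguments sqr_sol (k c)%_R.

(** Each sum [s c] is at most 2, since a nonzero [c] is not both a square and [delta] times a
    square. The sums add up to [2 * #|F|] over all [c], so each of them equals 2. *)
Lemma card_sqr_sol c : (#|sqr_sol 1 c| + #|sqr_sol delta c| = 2)%N.
Proof.
have d0 := nonsquare_neq0.
have total k : k != 0 -> (\sum_c #|sqr_sol k c| = #|F|)%N.
  move=> k0; transitivity (\sum_(c : F) \sum_(y : F | (k * y ^+ 2 == c)%R) 1)%N.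
    by apply: eq_bigr => c' _; rewrite sum1dep_card.
  by rewrite -sum1_card [RHS](partition_big (fun z : F => k * z ^+ 2) predT) //=.
have le2 k c' : k != 0 -> (#|sqr_sol k c'| <= (c' != 0%R).+1)%N.
  move=> k0; case: (set_0Vmem (sqr_sol k c')) => [->|[y0 y0c]].
    by rewrite cards0.
  have sub : sqr_sol k c' \subset [set y0; - y0].
    apply/subsetP => y; move: y0c; rewrite !inE => /eqP<- /eqP/(mulfI k0)/eqP.
    by rewrite eqf_sqr.
  rewrite (leq_trans (subset_leq_card sub)) // cards2 ltnS.
  case: (c' =P 0) y0c => [->|] /=; last by case: (y0 != _).
  by rewrite inE mulf_eq0 (negPf k0) expf_eq0 /= => /eqP->; rewrite oppr0 eqxx.
pose s k := (#|sqr_sol 1 k| + #|sqr_sol delta k|)%N.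
have s2 k : (s k <= 2)%N.
  have [k0|k0] := eqVneq k 0.
    by rewrite (leq_trans (leq_add (le2 1 k _) (le2 delta k _))) ?oner_neq0 // k0 eqxx.
  rewrite /s; case: (set_0Vmem (sqr_sol 1 k)) => [->|[y yk]].
    by rewrite cards0 (leq_trans (le2 _ _ d0)) // k0.
  suff -> : sqr_sol delta k = set0.
    by rewrite cards0 addn0 (leq_trans (le2 _ _ _)) ?oner_neq0 // k0.
  apply/setP => z; rewrite !inE; apply/negP => /eqP zk.
  have z0 : z != 0 by apply: contraNneq k0 => z0; rewrite -zk z0 expr0n mulr0.
  move: yk; rewrite inE mul1r => /eqP yk.
  have /eqP[] := delta_nonsquare (y / z).
  by rewrite expr_div_n yk -zk mulfK // expf_neq0.
have : (\sum_k (2 - s k) == 0)%N.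
  rewrite sumnB // sum_nat_const big_split !total ?oner_neq0 //= mulnC mul2n.
  by rewrite addnn subnn.
rewrite sum_nat_eq0 => /forallP/(_ c) /=; rewrite subn_eq0 => sc.
by apply/eqP; rewrite eqn_leq s2.
Qed.

Definition perp2 a b : {set V} := [set w | (B a w == 0) && (B b w == 0)].

Definition sphere_perp a : {set V} := [set x in sphere A | B a x == 0].

(** A vector orthogonal to [a] is uniquely [w + y *: b] with [w] orthogonal to both [a] and [b]; it
    is a unit vector when [Q b * y ^+ 2 = 1 - Q w]. *)
Lemma card_sphere_perp a b : B a b = 0 -> Q b != 0 ->
  #|sphere_perp a| =
  (\sum_(w in perp2 a b) #|sqr_sol (Q b) (1 - Q w)|)%N.
Proof.
move=> ab Qb.
under eq_bigr do rewrite -sum1_card.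
rewrite pair_big_dep /= -sum1_card.
pose f (p : V * F) : V := p.1 + p.2 *: b.
pose f' x : V * F := (x - (B b x / Q b) *: b, B b x / Q b).
rewrite (reindex_onto f f') => [|x _]; last by rewrite /f /f' /= subrK.
apply: eq_bigl => -[w y]; rewrite /f /f' !inE /= !(bilE symA) ab mulr0 addr0.
have -> : ((w + y *: b - ((B b w + y * Q b) / Q b) *: b,
            (B b w + y * Q b) / Q b) == (w, y)) = (B b w == 0).
  apply/eqP/eqP => [[_ /eqP]|->].
    by rewrite mulrDl mulfK // -subr_eq0 addrK mulf_eq0 invr_eq0 (negPf Qb) orbF => /eqP.
  by rewrite add0r mulfK // addrK.
case: (B b w =P 0) => [bw|_]; last by rewrite !andbF.
rewrite !andbT [RHS]andbC (bilC symA w b) bw !mulr0 addr0 add0r.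
by congr (_ && _); rewrite -subr_eq0 -[in RHS]subr_eq0; congr (_ == 0); ring.
Qed.

(** [refl A e] moves exactly the unit vectors outside [sphere_perp e], and its parity is that of
    half their number. Adding the counts for [a] and [b] gives [#|W| + ka + kb = #|sphere A|], with
    [#|W|] odd and the right side even. *)
Lemma spin_refl_neq a b : B a b = 0 -> Q a = 1 -> Q b = delta ->
  spin A (refl A a) != spin A (refl A b).
Proof.
move=> ab Qa Qb; have d0 := nonsquare_neq0.
have ba : B b a = 0 by rewrite (bilC symA).
have moved (e : V) : Q e != 0 -> exists2 k,
    (#|sphere_perp e| + k.*2 = #|sphere A|)%N &
    spin A (refl A e) = odd k.
  move=> Qe; have [k ck ->] :=
    spin_involution (refl_isometry symA e) (refl_mulgg symA e).
  exists k => //; rewrite -ck -(cardsID [set x | B e x == 0] (sphere A)).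
  congr (_ + _)%N; apply: eq_card => x; first by rewrite !inE.
  rewrite !inE andbC; congr (~~ _ && _).
  exact: refl_fixE.
have [|ka Na ->] := moved a; first by rewrite Qa oner_neq0.
have [|kb Nb ->] := moved b; first by rewrite Qb.
pose W := perp2 a b.
(* [W] and the sphere are stable under negation, whose only fixed vector 0 lies in [W] and not in
   the sphere. *)
have oddW : odd #|W|.
  have W0 : 0 \in W by rewrite inE !bil0r // eqxx.
  rewrite (cardsD1 0) W0 oddD addTb.
  apply: (@odd_card_fixedfree _ (fun x => - x)) => x.
  rewrite !inE !(bilE symA) !oppr_eq0 opprK => /andP[x0 ->]; split=> //.
    by rewrite x0.
  by rewrite -subr_eq0 -opprD oppr_eq0 -mulr2n -scaler_nat scaler_eq0 negb_or two_neq0.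
have evenS : ~~ odd #|sphere A|.
  apply: (@odd_card_fixedfree _ (fun x => - x)) => x.
  rewrite !inE !(bilE symA) opprK => Qx; split=> //; first by rewrite opprK.
  rewrite -subr_eq0 -opprD oppr_eq0 -mulr2n -scaler_nat scaler_eq0 negb_or two_neq0.
  by apply: contraTneq Qx => ->; rewrite bil0l // eq_sym oner_eq0.
(* Over each [w] in [W] the fibres are [sqr_sol delta (1 - Q w)] and [sqr_sol 1 (1 - Q w)], with 2
   elements in total. *)
have NaNb : (#|sphere_perp a| +
             #|sphere_perp b| = #|W|.*2)%N.
  rewrite (card_sphere_perp ab) ?Qb // (card_sphere_perp ba) ?Qa ?oner_neq0 //.
  rewrite [X in (_ + X)%N](eq_bigl (fun w => w \in W)); last first.
    by move=> w; rewrite !inE andbC.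
  rewrite -big_split /= -muln2 -sum_nat_const; apply: eq_bigr => w _.
  by rewrite addnC card_sqr_sol.
have total : (#|W| + ka + kb = #|sphere A|)%N.
  apply: double_inj; rewrite -[RHS]addnn -{1}Na -Nb addnACA NaNb.
  by rewrite !doubleD addnA.
move: (congr1 odd total); rewrite !oddD oddW (negPf evenS).
by case: (odd ka); case: (odd kb).
Qed.

Lemma spin1 : spin A 1%g = false.
Proof.
have := spinM (group1 (form_isometries_group A)) (group1 (form_isometries_group A)).
by rewrite mulg1; case: spin.
Qed.

(** A homomorphism to a group of order 2 kills commutators, so its kernel contains the derived
    subgroup. *)
Lemma spin_derived g : g \in (special_form_isometries_group A)^`(1)%g ->
  spin A g = false.
Proof.
have subSO : SO \subset O by apply/subsetP => h; rewrite inE => /andP[].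
have spinV h : h \in O -> spin A h^-1%g = spin A h.
  move=> hO; have := spinM hO (groupVr hO); rewrite mulgV spin1.
  by case: (spin A h); case: (spin A h^-1%g).
have KG : group_set [set h in O | ~~ spin A h].
  apply/group_setP; split; first by rewrite inE group1 spin1.
  move=> h k; rewrite inE => /andP[hO hs]; rewrite inE => /andP[kO ks].
  by rewrite inE groupM //= spinM // (negPf hs) (negPf ks).
suff /subsetP sub : ((special_form_isometries_group A)^`(1) \subset Group KG)%g.
  by move/sub; rewrite inE => /andP[_ /negPf].
rewrite gen_subG; apply/subsetP => _ /imset2P[h k /(subsetP subSO) hO /(subsetP subSO) kO ->].
have hVO := groupVr hO; have kVO := groupVr kO.
rewrite inE groupR //= commgEl conjgE !spinM ?groupM // !spinV //.
by case: (spin A h); case: (spin A k).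
Qed.

End SpinOfReflections.

(** * Involutions modulo the derived subgroup *)

Section InvolutionsModDerived.

Variables (F : finFieldType) (n : nat) (A : 'M[F]_n.+1) (delta : F).
Hypotheses (two_neq0 : 2%:R != 0 :> F) (symA : A^T = A) (unitA : A \in unitmx).
Hypothesis delta_nonsquare : forall c : F, c ^+ 2 != delta.

Local Notation V := 'cV[F]_n.+1.
Local Notation GL := {'GL_n.+1[F]}.
Local Notation B := (bil A).
Local Notation Q x := (bil A x x).
Local Notation O := (form_isometries A).
Local Notation SO := (special_form_isometries A).
Local Notation Omega := ((special_form_isometries_group A)^`(1)%g).
Local Notation r := (refl A).
Implicit Types (x y u v w a b : V) (c k e : F) (g h t : GL).

Definition eigen t e : {set V} := [set x | t *v x == e *: x].
Arguments eigen t%_g e%_R.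

Lemma eigenP t e x : reflect (t *v x = e *: x) (x \in eigen t e).
Proof. by rewrite inE; apply: eqP. Qed.

Lemma eigenD t e : {in eigen t e &, forall x y, x + y \in eigen t e}.
Proof.
by move=> x y /eigenP xe /eigenP ye; apply/eigenP; rewrite mulmxDr xe ye scalerDr.
Qed.

Lemma eigenZ t e c : {in eigen t e, forall x, c *: x \in eigen t e}.
Proof.
by move=> x /eigenP xe; apply/eigenP; rewrite -scalemxAr xe !scalerA mulrC.
Qed.

Lemma involution_actK t x : (t * t = 1)%g -> t *v (t *v x) = x.
Proof. by move=> tt; rewrite -GL_actM tt GL_act1. Qed.

Lemma eigen_symmetrize t e x : (t * t = 1)%g -> e ^+ 2 = 1 ->
  x + e *: (t *v x) \in eigen t e.
Proof.
move=> tt ee; apply/eigenP; rewrite mulmxDr -scalemxAr involution_actK //.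
by rewrite scalerDr scalerA -expr2 ee scale1r addrC.
Qed.

(** Take [y] in the whole space with [B u y] nonzero. Symmetrizing [y] into the eigenspace doubles
    its pairing with [u], because [t] is an isometry and [t *v u = e *: u]. *)
Lemma eigen_nondegenerate t e u : t \in O -> (t * t = 1)%g -> e ^+ 2 = 1 ->
  u \in eigen t e -> u != 0 -> exists2 v, v \in eigen t e & B u v != 0.
Proof.
move=> tO tt ee ue u0; have [y uy] := bil_nondegenerate unitA u0.
exists (y + e *: (t *v y)); first exact: eigen_symmetrize.
have -> : B u (y + e *: (t *v y)) = 2%:R * B u y; last by rewrite mulf_neq0.
rewrite !(bilE symA) -[B u (t *v y)](form_isometriesP two_neq0 symA t tO) involution_actK //.
rewrite (eigenP _ _ _ ue) !(bilE symA) mulrA -expr2 ee mul1r.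
by ring.
Qed.

(** If [u] and [v] are both isotropic, then [Q (u + v) = 2 * B u v]. *)
Lemma anisotropic_exists (U : {pred V}) u v :
    {in U &, forall x y, x + y \in U} -> u \in U -> v \in U -> B u v != 0 ->
  exists2 w, w \in U & Q w != 0.
Proof.
move=> UD uU vU uv; have [Qu|] := eqVneq (Q u) 0; last by exists u.
have [Qv|] := eqVneq (Q v) 0; last by exists v.
exists (u + v); first exact: UD.
rewrite !(bilE symA) Qu Qv add0r addr0 [B v u](bilC symA).
by rewrite -mulr2n -mulr_natl mulf_neq0.
Qed.

Lemma eigen_anisotropic t e u : t \in O -> (t * t = 1)%g -> e ^+ 2 = 1 ->
  u \in eigen t e -> u != 0 -> exists2 w, w \in eigen t e & Q w != 0.
Proof.
move=> tO tt ee ue u0; have [v ve uv] := eigen_nondegenerate tO tt ee ue u0.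
exact: anisotropic_exists (@eigenD t e) ue ve uv.
Qed.

Lemma normalize a : Q a != 0 ->
  exists c, (Q (c *: a) == 1) || (Q (c *: a) == delta).
Proof.
move=> Qa; have := card_sqr_sol delta_nonsquare (Q a)^-1.
have [->|[y]] := set_0Vmem (sqr_sol 1 (Q a)^-1); last first.
  rewrite inE mul1r => /eqP yQ _; exists y.
  by rewrite !(bilE symA) mulrA -expr2 yQ mulVf // eqxx.
have [->|[y]] := set_0Vmem (sqr_sol delta (Q a)^-1); first by rewrite !cards0.
(* Here [delta * y ^+ 2] is the inverse of [Q a]; the extra factor [delta] in the scalar turns the
   value into [delta] itself. *)
rewrite inE => /eqP yQ _; exists (delta * y); apply/orP; right.
rewrite !(bilE symA); apply/eqP.
transitivity (delta * (delta * y ^+ 2) * Q a); first by ring.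
by rewrite yQ mulfVK.
Qed.

(** The dimension [n.+1] is at least 3, so by pigeonhole some nonzero [u] is orthogonal to [v] and
    [w]. Projecting a vector [y] with [B u y] nonzero off [v] and [w] keeps that pairing, and
    [anisotropic_exists] applies. *)
Lemma perp2_anisotropic v w : (1 < n)%N -> B v w = 0 -> Q v != 0 -> Q w != 0 ->
  exists u, [/\ B v u = 0, B w u = 0 & Q u != 0].
Proof.
move=> n_gt1 vw Qv Qw.
have [u u0 [vu wu]] : exists2 u, u != 0 & B v u = 0 /\ B w u = 0.
  pose f x := (B v x, B w x).
  have /injectivePn[x [y xy []]] : ~~ injectiveb f.
    apply/injectiveP => f_inj.
    have := leq_card f f_inj; rewrite card_prod card_mx muln1 mulnn leqNgt.
    by rewrite ltn_exp2l ?card_finNzRing_gt1 // ltnS n_gt1.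
  move=> vxy wxy; exists (x - y); first by rewrite subr_eq0.
  by rewrite !(bilE symA) vxy wxy !subrr.
have wv : B w v = 0 by rewrite (bilC symA).
have [y uy] := bil_nondegenerate unitA u0.
pose U : {pred V} := [pred x | (B v x == 0) && (B w x == 0)].
pose y' := y - (B v y / Q v) *: v - (B w y / Q w) *: w.
have [|||| u'] := @anisotropic_exists U u y'.
- move=> a b /andP[/eqP va /eqP wa] /andP[/eqP vb /eqP wb].
  by rewrite inE !(bilE symA) va wa vb wb !addr0 eqxx.
- by rewrite inE vu wu eqxx.
- rewrite inE /y' !(bilE symA) vw wv !mulr0 !divfK // !subr0.
  by rewrite !subrr eqxx.
- rewrite /y' !(bilE symA) [B u v](bilC symA) vu [B u w](bilC symA) wu.
  by rewrite !mulr0 !subr0.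
by move=> /andP[/eqP vu' /eqP wu'] Qu'; exists u'.
Qed.

Lemma special_refl2 v w : Q v != 0 -> Q w != 0 -> (r v * r w)%g \in SO.
Proof.
move=> Qv Qw; rewrite inE; apply/andP; split.
  by apply: form_isometriesM; apply: refl_isometry.
by rewrite GL_MxE det_mulmx !det_refl // mulrNN mulr1.
Qed.

(** The reflection along [v - w] carries [v] to [w], so [r v * r w] is the commutator of [r v] and
    [r (v - w)]. Multiplying both by [r u], with [u] orthogonal to [v] and [w], brings them into
    [SO] without changing the commutator. *)
Lemma refl2_derived v w : (1 < n)%N -> B v w = 0 -> Q v = Q w -> Q v != 0 ->
  (r v * r w)%g \in Omega.
Proof.
move=> n_gt1 vw Qvw Qv; have Qw : Q w != 0 by rewrite -Qvw.
have wv : B w v = 0 by rewrite (bilC symA).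
have [u [vu wu Qu]] := perp2_anisotropic n_gt1 vw Qv Qw.
have uv : B u v = 0 by rewrite (bilC symA).
have uw : B u w = 0 by rewrite (bilC symA).
have Qd : Q (v - w) = 2%:R * Q v by rewrite !(bilE symA) vw wv -Qvw; ring.
have Qd0 : Q (v - w) != 0 by rewrite Qd mulf_neq0.
have rr a := refl_mulgg symA a.
pose g := (r v * r u)%g; pose h := (r (v - w) * r u)%g.
have hO : h \in O by apply: form_isometriesM; apply: refl_isometry.
have hv : h *v v = w.
  rewrite GL_actM (refl_fix symA uv) (reflE symA) Qd !(bilE symA) wv subr0.
  rewrite invfM mulrA divff // mul1r mulVf // scale1r opprB addrC.
  by rewrite subrK.
have hu : h *v u = - u.
  rewrite GL_actM refl_self // mulmxN refl_fix // !(bilE symA) vu wu.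
  by rewrite subrr.
have gSO := special_refl2 Qv Qu; have hSO := special_refl2 Qd0 Qu.
have gh : (r v * r w = [~ g, h^-1])%g.
  rewrite commgEl /g conjMg !(refl_conj two_neq0 symA _ hO) hv hu.
  rewrite -[- u]scaleN1r (reflZ symA) ?oppr_eq0 ?oner_neq0 // invMg !(refl_inv symA).
  rewrite (refl_commute symA uv) (refl_commute symA wu) mulgA.
  by rewrite -[(r v * _ * _)%g]mulgA rr mulg1.
by have := mem_commg gSO (groupVr hSO); rewrite -gh.
Qed.

Lemma eigen_perp t x y : t \in O -> x \in eigen t 1 -> y \in eigen t (-1) ->
  B x y = 0.
Proof.
move=> /(form_isometriesP two_neq0 symA) tB /eigenP tx /eigenP ty.
have /eqP : 2%:R * B x y = 0.
  rewrite -[RHS](subrr (B x y)) -{3}tB tx ty !(bilE symA); ring.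
by rewrite mulf_eq0 (negPf two_neq0) => /eqP.
Qed.

(** Conjugation by [t] takes [r a] to [r (e *: a)], which is [r a] again. *)
Lemma refl_eigen_commute t e a : t \in O -> e != 0 -> a \in eigen t e ->
  commute t (r a).
Proof.
move=> tO e0 /eigenP ta; have := refl_conj two_neq0 symA a tO.
rewrite ta (reflZ symA) // conjgE invgK => ra.
by rewrite /commute -{2}ra -!mulgA mulVg mulg1.
Qed.

Lemma mul_refl_involution t e a : t \in O -> (t * t = 1)%g -> e != 0 ->
  a \in eigen t e -> (t * r a * (t * r a) = 1)%g.
Proof.
move=> tO tt e0 ae; rewrite {1}(refl_eigen_commute tO e0 ae).
by rewrite -mulgA (mulgA t) tt mul1g refl_mulgg.
Qed.

(** If [t] moves [x], then [x - t *v x] is a nonzero element of the (-1)-eigenspace, which is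
    nondegenerate and thus contains an anisotropic vector to rescale. *)
Lemma minus_normal t : t \in O -> (t * t = 1)%g -> t != 1%g ->
  exists2 a, a \in eigen t (-1) & (Q a == 1) || (Q a == delta).
Proof.
move=> tO tt t1; have [x tx] : exists x : V, t *v x != x.
  apply/existsP; apply: contraNT t1; rewrite negb_exists => /forallP tx.
  by apply/eqP/GL_eqP => x; rewrite GL_act1; apply/eqP; rewrite -[_ == _]negbK.
have N1s : (-1) ^+ 2 = 1 :> F by rewrite sqrrN expr1n.
have [|w we Qw] := eigen_anisotropic tO tt N1s (eigen_symmetrize x tt N1s).
  by rewrite scaleN1r subr_eq0 eq_sym.
by have [c Qc] := normalize Qw; exists (c *: w); first exact: eigenZ.
Qed.

(** Diagonalization of [Q] on the (-1)-eigenspace, two reflections at a time: [t = t2 * r b * r a],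
    where [t2] has a smaller (-1)-eigenspace. Modulo [H], orthogonal reflections of equal value
    cancel, which leaves nothing or a single pair of values 1 and [delta]. *)
Lemma involution_mod_refl2 (H : {group GL}) t :
    (forall x y, B x y = 0 -> Q x = Q y -> Q x != 0 -> (r x * r y)%g \in H) ->
    t \in SO -> (t * t = 1)%g ->
  t \in H \/
  exists v w, [/\ v \in eigen t (-1), w \in eigen t (-1), B v w = 0,
                  Q v = 1 /\ Q w = delta & (t * (r v * r w))%g \in H].
Proof.
move=> pair_H; have d0 := nonsquare_neq0 delta_nonsquare.
(* [rho] is opaque, which keeps conversion from computing with reflections. *)
have [rho rhoE] : {rho : V -> GL | rho = r} by exists r.
have det_rho a : Q a != 0 -> \det (GLval (rho a)) = -1.
  by rewrite rhoE; apply: det_refl.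
have rho_self a : Q a != 0 -> rho a *v a = - a by rewrite rhoE; apply: refl_self.
have rho_fix a x : B a x = 0 -> rho a *v x = x by rewrite rhoE; apply: refl_fix.
have mul_rho_involution t' e a : t' \in O -> (t' * t' = 1)%g -> e != 0 ->
    a \in eigen t' e -> (t' * rho a * (t' * rho a) = 1)%g.
  by rewrite rhoE; apply: mul_refl_involution.
rewrite -rhoE in pair_H *.
have rC a b : B a b = 0 -> (rho a * rho b = rho b * rho a)%g by rewrite rhoE; apply: refl_commute.
have rr a : (rho a * rho a = 1)%g by rewrite rhoE; apply: refl_mulgg.
have rO a : rho a \in O by rewrite rhoE; apply: refl_isometry.
have N10 : -1 != 0 :> F by rewrite oppr_eq0 oner_neq0.
have normal_neq0 a : (Q a == 1) || (Q a == delta) -> Q a != 0.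
  by case/orP => /eqP->; rewrite ?oner_neq0.
have [m] := ubnP #|eigen t (-1)|; elim: m t => // m IHm t.
rewrite ltnS => card_t tSO tt.
have /andP[tO /eqP det_t] : (t \in O) && (\det (GLval t) == 1) by rewrite inE in tSO.
have [->|t_neq1] := eqVneq t 1%g; first by left; exact: group1.
have [a ae /[dup] Qa /normal_neq0 Qa0] := minus_normal tO tt t_neq1.
have [t1 t1E] : {t1 | t1 = (t * rho a)%g} by exists (t * rho a)%g.
have t1O : t1 \in O by rewrite t1E; apply: form_isometriesM.
have t1t1 : (t1 * t1 = 1)%g by rewrite t1E; apply: mul_rho_involution ae.
have det_t1 : \det (GLval t1) = -1.
  by rewrite t1E GL_MxE det_mulmx det_t det_rho // mul1r.
(* Determinant -1 forces a second vector [b] to exist: this is the evenness of the dimension of the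
   (-1)-eigenspace. *)
have t1_neq1 : t1 != 1%g.
  apply: contraNneq two_neq0 => t1_1; move: det_t1; rewrite t1_1 GL_1E det1 => /eqP.
  by rewrite -subr_eq0 opprK.
have [b be1 /[dup] Qb /normal_neq0 Qb0] := minus_normal t1O t1t1 t1_neq1.
have ta : t1 *v a = a.
  by rewrite t1E GL_actM rho_self // mulmxN (eigenP _ _ _ ae) scaleN1r opprK.
have ab : B a b = 0 by apply: eigen_perp t1O _ be1; apply/eigenP; rewrite scale1r.
have ba : B b a = 0 by rewrite (bilC symA).
have be : b \in eigen t (-1).
  by apply/eigenP; rewrite -(eigenP _ _ _ be1) t1E GL_actM rho_fix.
have [t2 t2E] : {t2 | t2 = (t1 * rho b)%g} by exists (t1 * rho b)%g.
have t2O : t2 \in O by rewrite t2E; apply: form_isometriesM.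
have t2t2 : (t2 * t2 = 1)%g by rewrite t2E; apply: mul_rho_involution be1.
have t2SO : t2 \in SO.
  by rewrite inE t2O t2E GL_MxE det_mulmx det_t1 det_rho // mulrNN mulr1 eqxx.
have t2a : a \in eigen t2 1.
  by apply/eigenP; rewrite t2E GL_actM (rho_fix _ _ ba) ?ta ?scale1r.
have t2b : b \in eigen t2 1.
  apply/eigenP; rewrite t2E GL_actM rho_self // mulmxN (eigenP _ _ _ be1).
  by rewrite scaleN1r scale1r opprK.
have eigen_t2 x : x \in eigen t2 (-1) -> [/\ B a x = 0, B b x = 0 & x \in eigen t (-1)].
  move=> xe; have ax := eigen_perp t2O t2a xe; have bx := eigen_perp t2O t2b xe.
  split=> //; apply/eigenP; rewrite -(eigenP _ _ _ xe) t2E GL_actM t1E GL_actM.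
  by rewrite (rho_fix _ _ bx) ?(rho_fix _ _ ax).
(* The inclusion of eigenspaces is strict: [a] is fixed by [t2], and it is anisotropic, hence not
   orthogonal to itself. *)
have card_t2 : (#|eigen t2 (-1)| < m)%N.
  apply: leq_trans card_t; apply: proper_card; apply/properP; split.
    by apply/subsetP => x /eigen_t2[].
  exists a => //; apply/negP => /(eigen_perp t2O t2a) Qa_eq0.
  by rewrite Qa_eq0 eqxx in Qa0.
have tE : t = (t2 * (rho b * rho a))%g.
  by rewrite t2E t1E (mulgK_involutions t (rr a) (rr b)).
have tE' : t = (t2 * (rho a * rho b))%g by rewrite (rC a b).
have ss x y (xy : B x y = 0) := mulg_involutions (rC _ _ xy) (rr x) (rr y).
have pair_in x y k : k != 0 -> Q x = k -> Q y = k -> B x y = 0 ->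
    (rho x * rho y)%g \in H.
  by move=> k0 Qx Qy xy; apply: pair_H; rewrite ?Qx ?Qy.
have in1 := @pair_in _ _ 1 (oner_neq0 F); have ind := @pair_in _ _ delta d0.
have [t2_in|[v [w [ve we vw [Qv Qw] t2_in]]]] := IHm t2 card_t2 t2SO t2t2.
  (* Nothing is left over from [t2]: [a] and [b] cancel if their values agree, and form the leftover
     pair otherwise. *)
  case/orP: Qa => /eqP Qa; case/orP: Qb => /eqP Qb.
  - by left; have := groupM t2_in (in1 b a Qb Qa ba); rewrite -tE.
  - right; exists a, b; split=> [|||//|]; [exact: ae|exact: be|exact: ab|].
    rewrite tE' (mulgK_involution t2 (ss _ _ ab)); exact t2_in.
  - right; exists b, a; split=> [|||//|]; [exact: be|exact: ae|exact: ba|].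
    rewrite tE (mulgK_involution t2 (ss _ _ ba)); exact t2_in.
  - by left; have := groupM t2_in (ind b a Qb Qa ba); rewrite -tE.
have [av bv vt] := eigen_t2 v ve; have [aw bw wt] := eigen_t2 w we.
have va : B v a = 0 by rewrite (bilC symA).
have vb : B v b = 0 by rewrite (bilC symA).
have wa : B w a = 0 by rewrite (bilC symA).
have wb : B w b = 0 by rewrite (bilC symA).
have comm : (t * (rho v * rho w) = t2 * (rho v * rho w) * (rho b * rho a))%g.
  rewrite -(mulg_commute_pairs t2 (rC _ _ av) (rC _ _ aw) (rC _ _ bv) (rC _ _ bw)).
  by rewrite -tE.
have tE2 : t = (t2 * (rho v * rho w) * (rho v * rho w * (rho b * rho a)))%g.
  by rewrite (mulg_insert_involution t2 (rho b * rho a)%g (ss _ _ vw)) -tE.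
(* A pair [v], [w] is left over from [t2]: if [a] and [b] have equal values they cancel and the pair
   stays; otherwise each of [a], [b] cancels against the one of [v], [w] with its value. *)
case/orP: Qa => /eqP Qa; case/orP: Qb => /eqP Qb.
- right; exists v, w; split=> [|||//|]; [exact: vt|exact: wt|exact: vw|].
  by have := groupM t2_in (in1 b a Qb Qa ba); rewrite -comm.
- left; have := groupM t2_in (groupM (in1 v a Qv Qa va) (ind w b Qw Qb wb)).
  by rewrite -(mulg_shuffle1 (rho v) (rC _ _ aw) (rC _ _ ab)) -tE2.
- left; have := groupM t2_in (groupM (in1 v b Qv Qb vb) (ind w a Qw Qa wa)).
  by rewrite -(mulg_shuffle2 (rho a) (rho v) (rC _ _ wb)) -tE2.
- right; exists v, w; split=> [|||//|]; [exact: vt|exact: wt|exact: vw|].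
  by have := groupM t2_in (ind b a Qb Qa ba); rewrite -comm.
Qed.

(** If a pair [v], [w] is left over, then [t * (r v * r w)] lies in [Omega], so [t] has the same
    character value as [r v * r w], which is nontrivial by [spin_refl_neq]. *)
Lemma involution_derivedE t : (1 < n)%N -> t \in SO -> (t * t = 1)%g ->
  (t \in Omega) = ~~ spin A t.
Proof.
move=> n_gt1 tSO tt; apply/idP/idP => [/spin_derived->//|].
have pair_in x y (xy : B x y = 0) (Qxy : Q x = Q y) (Qx : Q x != 0) :=
  refl2_derived n_gt1 xy Qxy Qx.
have [//|[v [w [_ _ vw [Qv Qw] t_in]]]] :=
  @involution_mod_refl2 (special_form_isometries_group A)^`(1)%G t pair_in tSO tt.
have tO : t \in O by rewrite inE in tSO; case/andP: tSO.
have [vO wO] := (refl_isometry symA v, refl_isometry symA w).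
have /spin_derived := t_in; rewrite (spinM tO (form_isometriesM vO wO)) (spinM vO wO).
have := spin_refl_neq two_neq0 symA delta_nonsquare vw Qv Qw.
by case: (spin A (r v)); case: (spin A (r w)); case: (spin A t).
Qed.

End InvolutionsModDerived.

Arguments eigen {F n} t%_g e%_R.

(** * Distribution of the values of the form *)

Section ValueDistribution.

Variables (F : finFieldType) (n : nat) (A : 'M[F]_n.+1).
Hypotheses (two_neq0 : 2%:R != 0 :> F) (symA : A^T = A).

Local Notation V := 'cV[F]_n.+1.
Local Notation B := (bil A).
Local Notation Q x := (bil A x x).
Local Notation q := #|F|.
Implicit Types (x y u v w a b : V) (c k e : F) (U : {set V}).

Definition level U c : {set V} := [set x in U | Q x == c].

Lemma sum_level U : (\sum_c #|level U c| = #|U|)%N.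
Proof.
transitivity (\sum_c \sum_(x in U | (Q x == c)%R) 1)%N.
  by apply: eq_bigr => c _; rewrite -sum1_card; apply: eq_bigl => x; rewrite inE.
by rewrite -sum1_card [RHS](partition_big (fun x => Q x) predT).
Qed.

Variable U : {set V}.
Hypotheses (UD : {in U &, forall x y, x + y \in U})
           (UZ : forall c, {in U, forall x, c *: x \in U})
           (U_nondeg : {in U, forall u, u != 0 -> exists2 v, v \in U & B u v != 0}).

(** The functional [B u] maps [U] onto [F], and its fibres are translates of its kernel. *)
Lemma card_perp u : u \in U -> u != 0 ->
  (q * #|[set v in U | (B u v == 0)%R]| = #|U|)%N.
Proof.
move=> uU u0; have [v vU uv] := U_nondeg uU u0.
transitivity (\sum_c \sum_(x in U | (B u x == c)%R) 1)%N; last first.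
  by rewrite -sum1_card [RHS](partition_big (fun x => B u x) predT).
rewrite -sum_nat_const; apply: eq_big => // c _.
rewrite sum1dep_card; pose s := (c / B u v) *: v.
have sU : s \in U by exact: UZ.
have us : B u s = c by rewrite bilZr // divfK.
rewrite -(card_imset _ (addIr s)); apply: eq_card => x; rewrite [RHS]inE.
apply/imsetP/andP => [[y]|[xU /eqP ux]].
  by rewrite inE => /andP[yU /eqP uy] ->; rewrite UD // bilDr // uy us add0r.
exists (x - s); last by rewrite subrK.
by rewrite inE UD -?scaleN1r ?UZ // bilDr // bilZr // us ux mulN1r subrr eqxx.
Qed.

(** The left side counts pairs of elements of [U] with equal values of [Q]. Written as [x + y] and
    [x - y], they have equal values exactly when [B x y = 0], the difference of the values being
    [4 * B x y] up to sign. *)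
Lemma level_pairs :
  (\sum_c #|level U c| ^ 2 =
   \sum_(u in U) #|[set v in U | (B u v == 0)%R]|)%N.
Proof.
transitivity (\sum_(x in U) \sum_(y in U | (Q y == Q x)%R) 1)%N.
  rewrite (partition_big (fun x => Q x) predT) //=; apply: eq_bigr => c _.
  transitivity (\sum_(x in level U c) #|level U c|)%N.
    by rewrite sum_nat_const mulnn.
  apply: eq_big => [x|x]; first by rewrite inE.
  rewrite inE => /andP[_ /eqP->]; rewrite -sum1_card.
  by apply: eq_bigl => y; rewrite inE.
rewrite pair_big_dep [RHS](eq_bigr _ (fun _ _ => esym (sum1_card _))) pair_big_dep /=.
pose f (p : V * V) : V * V := (p.1 + p.2, p.1 - p.2).
pose g (p : V * V) : V * V := (2%:R^-1 *: (p.1 + p.2), 2%:R^-1 *: (p.1 - p.2)).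
have half x : 2%:R^-1 *: (x + x) = x.
  by rewrite -mulr2n -scaler_nat scalerA mulVf // scale1r.
have e1 x y : x + y + (x - y) = x + x by rewrite addrACA subrr addr0.
have e2 x y : x + y - (x - y) = y + y by rewrite opprB (addrC x) e1.
have fK : cancel f g by move=> [x y]; rewrite /g /f /= e1 e2 !half.
have gK : cancel g f.
  by move=> [x y]; rewrite /g /f /= -scalerDr -scalerBr e1 e2 !half.
rewrite (reindex f) /=; last by exists g => p _; [apply: fK|apply: gK].
apply: eq_bigl => -[x y]; rewrite /f /= inE.
have -> : (Q (x - y) == Q (x + y)) = (B x y == 0).
  rewrite -subr_eq0 (_ : _ - _ = - (2%:R * 2%:R * B x y)); last first.
    by rewrite !(bilE symA) [B y x](bilC symA); ring.
  by rewrite oppr_eq0 !mulf_eq0 (negPf two_neq0).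
rewrite !andbA; congr (_ && _); apply/andP/andP => [[xyU xyU']|[xU yU]]; last first.
  by rewrite UD // -scaleN1r UD // UZ.
split; first by rewrite -[x]half -(e1 x y) UZ // UD.
by rewrite -[y]half -(e2 x y) UZ // UD // -[- (x - y)]scaleN1r UZ.
Qed.

(** In [level_pairs] the vector 0 contributes [#|U|], and every other [u] contributes [#|U|] divided
    by [q]. Both sides are arranged to avoid subtraction. *)
Lemma level_second_moment : 0 \in U ->
  (q * \sum_c #|level U c| ^ 2 + #|U| = q * #|U| + #|U| ^ 2)%N.
Proof.
move=> U0; rewrite level_pairs (bigD1 0) //= mulnDr -addnA; congr (_ + _)%N.
  by congr (_ * _)%N; apply: eq_card => v; rewrite inE bil0l eqxx andbT.
rewrite big_distrr /= (eq_bigr (fun=> #|U|)); last first.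
  by move=> u /andP[uU u0]; rewrite card_perp.
rewrite sum_nat_const -mulSnr -mulnn; congr (_ * _)%N.
by rewrite [RHS](cardD1 0) U0 add1n; congr _.+1; apply: eq_card => u; rewrite !inE andbC.
Qed.

(* Chebyshev: the variance of the value of [Q] on [U] is controlled by the
   number of orthogonal pairs in [U]. *)
Lemma level_deviation (R : realFieldType) c : 0 \in U ->
  (q%:R * #|level U c|%:R - #|U|%:R) ^+ 2 <= q%:R ^+ 2 * #|U|%:R :> R.
Proof.
move=> U0; have sm := congr1 (fun k : nat => k%:R : R) (level_second_moment U0).
rewrite natrD natrM natrD natrM natrX natr_sum in sm.
have s1 := congr1 (fun k : nat => k%:R : R) (sum_level U); rewrite natr_sum in s1.
have total : \sum_c (q%:R * #|level U c|%:R - #|U|%:R) ^+ 2 =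
    q%:R ^+ 2 * #|U|%:R - q%:R * #|U|%:R :> R.
  transitivity (q%:R ^+ 2 * (\sum_c #|level U c|%:R ^+ 2)
     - 2%:R * q%:R * #|U|%:R * (\sum_c #|level U c|%:R) + q%:R * #|U|%:R ^+ 2 : R).
    rewrite !mulr_sumr -sumrB.
    have -> : q%:R * #|U|%:R ^+ 2 = \sum_(c : F) #|U|%:R ^+ 2 :> R.
      by rewrite sumr_const mulr_natl.
    by rewrite -big_split /=; apply: eq_bigr => k _; ring.
  rewrite s1; under eq_bigr do rewrite -natrX.
  have : \sum_c (#|level U c| ^ 2)%:R * (q%:R : R) = q%:R * #|U|%:R + #|U|%:R ^+ 2 - #|U|%:R.
    by rewrite -mulr_suml mulrC -sm addrK.
  rewrite -mulr_suml => E; rewrite expr2 -mulrA [_ * \sum__ _]mulrC E; ring.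
apply: (@le_trans _ _ (\sum_c (q%:R * #|level U c|%:R - #|U|%:R) ^+ 2)).
  rewrite (bigD1 c) //= lerDl sumr_ge0 // => k _; exact: sqr_ge0.
by rewrite total gerDl oppr_le0 mulr_ge0 // ler0n.
Qed.

(** Once [#|U|] is at least [q ^ 2 * M ^ 2], the bound of [level_deviation] is at most the square of
    [#|U| / M], so the relative error is at most [1 / M]. *)
Lemma level_approx (R : realFieldType) (M : nat) c : 0 \in U ->
    (q ^ 2 * M ^ 2 <= #|U|)%N ->
  M%:R * `|q%:R * #|level U c|%:R - #|U|%:R| <= #|U|%:R :> R.
Proof.
move=> U0 big_U; have dev := level_deviation R c U0.
rewrite -(@ler_pXn2r _ 2%N) ?nnegrE ?mulr_ge0 ?ler0n ?normr_ge0 //.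
rewrite exprMn real_normK ?num_real //.
apply: le_trans (ler_wpM2l (exprn_ge0 2 (ler0n _ _)) dev) _.
rewrite mulrA [leRHS]expr2 ler_wpM2r ?ler0n //.
by rewrite -!natrX -natrM ler_nat mulnC.
Qed.

End ValueDistribution.

Arguments level {F n} A%_R U c%_R.

(** * Flipping the character *)

Section InvolutionCounts.

Variables (F : finFieldType) (n : nat) (A : 'M[F]_n.+1) (delta : F).
Hypotheses (two_neq0 : 2%:R != 0 :> F) (symA : A^T = A) (unitA : A \in unitmx).
Hypothesis delta_nonsquare : forall c : F, c ^+ 2 != delta.

Local Notation V := 'cV[F]_n.+1.
Local Notation GL := {'GL_n.+1[F]}.
Local Notation B := (bil A).
Local Notation Q x := (bil A x x).
Local Notation O := (form_isometries A).
Local Notation r := (refl A).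
Local Notation q := #|F|.
Implicit Types (x y u v w a b : V) (c k e d : F) (g h t : GL).

(** The determinant is a parameter because multiplication by one reflection, or negation in odd
    dimension, changes its sign. *)
Definition involutions d : {set GL} :=
  [set t in O | (t * t == 1)%g && (\det (GLval t) == d)].
Arguments involutions d%_R.

Lemma involutionsP d t :
  reflect [/\ t \in O, (t * t = 1)%g & \det (GLval t) = d] (t \in involutions d).
Proof.
apply: (iffP idP) => [|[tO tt td]].
  by rewrite in_set => /andP[tO /andP[/eqP tt /eqP td]]; split.
by rewrite in_set tt td !eqxx !andbT.
Qed.

Lemma eigen_level_approx (R : realFieldType) (M : nat) t e c :
    t \in O -> (t * t = 1)%g -> e ^+ 2 = 1 ->
    (q ^ 2 * M ^ 2 <= #|eigen t e|)%N ->
  M%:R * `|q%:R * #|level A (eigen t e) c|%:R - #|eigen t e|%:R|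
    <= #|eigen t e|%:R :> R.
Proof.
move=> tO tt ee; apply: level_approx => //.
- exact: eigenD.
- by move=> k x; apply: eigenZ.
- by move=> u ue u0; apply: eigen_nondegenerate.
- by apply/eigenP; rewrite mulmx0 scaler0.
Qed.

Lemma card_eigen t : (t * t = 1)%g ->
  (#|eigen t 1| * #|eigen t (-1)| = q ^ n.+1)%N.
Proof.
move=> tt; have half x : 2%:R^-1 *: (x + x) = x.
  by rewrite -mulr2n -scaler_nat scalerA mulVf // scale1r.
have N1s : (-1) ^+ 2 = 1 :> F by rewrite sqrrN expr1n.
have <- : #|{: V}| = (q ^ n.+1)%N by rewrite card_mx muln1.
rewrite -cardsX -cardsT.
pose f (p : V * V) := p.1 + p.2.
have f_inj : {in setX (eigen t 1) (eigen t (-1)) &, injective f}.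
  move=> [x y] [x' y'] /setXP[/eigenP xe /eigenP ye] /setXP[/eigenP xe' /eigenP ye'].
  rewrite /f /= => E; have := congr1 (mulmx (GLval t)) E.
  rewrite !mulmxDr xe ye xe' ye' !scaleN1r !scale1r => E'.
  have xx : x = x'.
    rewrite -[x]half -[x']half; congr (_ *: _).
    have := congr2 +%R E E'; rewrite !(addrACA _ y) !(addrACA _ y') !subrr !addr0.
    exact.
  by move: E; rewrite xx => /addrI->.
rewrite -(card_in_imset f_inj); apply: eq_card => x; rewrite inE.
apply/imsetP; exists (2%:R^-1 *: (x + t *v x), 2%:R^-1 *: (x - t *v x)).
  have := (eigen_symmetrize x tt (expr1n F 2), eigen_symmetrize x tt N1s).
  by rewrite scale1r scaleN1r => -[h1 h2]; rewrite inE /= !eigenZ.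
by rewrite /f /= -scalerDr addrACA subrr addr0 half.
Qed.

(** Both assignments of the values 1 and [delta] are allowed, so that [flip], which exchanges [a]
    and [b], preserves the condition. *)
Definition balanced t : {set V * V} :=
  setX (level A (eigen t 1) 1) (level A (eigen t (-1)) delta) :|:
  setX (level A (eigen t 1) delta) (level A (eigen t (-1)) 1).

Lemma balancedP t a b :
  reflect [/\ a \in eigen t 1, b \in eigen t (-1) &
              Q a = 1 /\ Q b = delta \/ Q a = delta /\ Q b = 1]
    ((a, b) \in balanced t).
Proof.
rewrite !inE; apply: (iffP orP) => [[]|].
- by move=> /andP[/andP[-> /eqP->] /andP[-> /eqP->]]; split=> //; left.
- by move=> /andP[/andP[-> /eqP->] /andP[-> /eqP->]]; split=> //; right.
- by move=> [-> -> [[-> ->]|[-> ->]]]; rewrite !eqxx; [left|right].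
Qed.

Lemma card_balanced t : #|balanced t| =
  (#|level A (eigen t 1) 1| * #|level A (eigen t (-1)) delta| +
   #|level A (eigen t 1) delta| * #|level A (eigen t (-1)) 1|)%N.
Proof.
rewrite /balanced cardsU !cardsX -[RHS]subn0; congr (_ - _)%N.
apply: eq_card0 => -[a b]; rewrite !inE; apply/negP.
case/andP=> /andP[/andP[_ /eqP->] _] /andP[/andP[_ /eqP E] _].
(* The two products are disjoint because 1 is a square and [delta] is not. *)
by have /eqP[] := delta_nonsquare 1; rewrite expr1n E.
Qed.

Definition flip (p : GL * (V * V)) : GL * (V * V) :=
  ((p.1 * r p.2.1 * r p.2.2)%g, (p.2.2, p.2.1)).

Lemma flipK : involutive flip.
Proof.
move=> [t [a b]]; congr pair => /=.
exact (mulgK_involutions2 t (refl_mulgg symA a) (refl_mulgg symA b)).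
Qed.

Lemma flip_balanced t a b : t \in involutions 1 -> (a, b) \in balanced t ->
  [/\ (t * r a * r b)%g \in involutions 1, (b, a) \in balanced (t * r a * r b)%g &
      spin A (t * r a * r b)%g = ~~ spin A t].
Proof.
move=> /involutionsP[tO tt dt] /balancedP[ae be Qab].
have d0 := nonsquare_neq0 delta_nonsquare.
have [Qa Qb] : Q a != 0 /\ Q b != 0.
  by case: Qab => -[-> ->]; rewrite oner_neq0 d0.
have ab := eigen_perp two_neq0 symA tO ae be.
have ba : B b a = 0 by rewrite (bilC symA).
have [aO bO] := (refl_isometry symA a, refl_isometry symA b).
have taO := form_isometriesM tO aO.
have be' : b \in eigen (t * r a)%g (-1).
  by apply/eigenP; rewrite GL_actM refl_fix // (eigenP _ _ _ be).
have N10 : -1 != 0 :> F by rewrite oppr_eq0 oner_neq0.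
have tat := mul_refl_involution two_neq0 symA tO tt (oner_neq0 F) ae.
split.
- apply/involutionsP; split; first exact: form_isometriesM.
    exact (mul_refl_involution two_neq0 symA taO tat N10 be').
  by rewrite 2!GL_MxE !det_mulmx !det_refl // dt mul1r mulrNN mulr1.
- apply/balancedP; split; last by case: Qab; [right|left]; tauto.
    apply/eigenP; rewrite GL_actM refl_self // mulmxN (eigenP _ _ _ be').
    by rewrite scaleN1r opprK scale1r.
  apply/eigenP; rewrite !GL_actM (refl_fix _ ba) // refl_self // mulmxN.
  by rewrite (eigenP _ _ _ ae) scaleN1r scale1r.
rewrite (spinM taO bO) (spinM tO aO).
have : spin A (r a) != spin A (r b).
  have neq := spin_refl_neq two_neq0 symA delta_nonsquare.
  by case: Qab => -[Qa' Qb']; [|rewrite eq_sym]; apply: neq.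
by case: (spin A (r a)); case: (spin A (r b)); case: (spin A t).
Qed.

(** Written as a sum over triples [(t, (a, b))] and reindexed by [flip], the sum equals its own
    opposite. *)
Lemma sum_spin_balanced (R : realFieldType) :
  \sum_(t in involutions 1) (-1) ^+ spin A t * #|balanced t|%:R = 0 :> R.
Proof.
pose E := [set p : GL * (V * V) | (p.1 \in involutions 1) && (p.2 \in balanced p.1)].
have EE p : (p \in E) = (p.1 \in involutions 1) && (p.2 \in balanced p.1).
  by rewrite [LHS]in_set.
have flipE p : p \in E -> flip p \in E /\ spin A (flip p).1 = ~~ spin A p.1.
  case: p => t [a b]; rewrite !EE /= => /andP[tI ab].
  by have [h1 h2 h3] := flip_balanced tI ab; rewrite h1 h2.
pose S : R := \sum_(p in E) (-1) ^+ spin A p.1.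
have -> : \sum_(t in involutions 1) (-1) ^+ spin A t * #|balanced t|%:R = S.
  transitivity (\sum_(t in involutions 1) \sum_(p in balanced t) (-1) ^+ spin A t : R).
    by apply: eq_bigr => t _; rewrite sumr_const mulr_natr.
  by rewrite pair_big_dep; apply: eq_bigl => p; rewrite EE.
have SN : S = - S.
  rewrite {1}/S (reindex_inj (inv_inj flipK)) -sumrN.
  apply: eq_big => [p|p pE]; last first.
    by have [_] := flipE _ pE; rewrite flipK => ->; case: (spin A _); rewrite ?opprK.
  apply/idP/idP => [/flipE[]|/flipE[]//]; by rewrite flipK.
have : 2%:R * S = 0 by rewrite mulr2n mulrDl mul1r {1}SN addNr.
by move/eqP; rewrite mulf_eq0 pnatr_eq0 => /eqP.
Qed.

End InvolutionCounts.

Arguments involutions {F n} A%_R d%_R.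

(** * Involutions with a small eigenspace *)

Lemma card_dep_pairs (S T : finType) (D : {set S}) (W : S -> {set T}) :
  #|[set p : S * T | (p.1 \in D) && (p.2 \in W p.1)]| = (\sum_(s in D) #|W s|)%N.
Proof.
rewrite -sum1_card (eq_bigr _ (fun _ _ => esym (sum1_card _))) pair_big_dep.
by apply: eq_bigl => p; rewrite inE.
Qed.

Section SmallEigenspaces.

Variables (F : finFieldType) (n : nat) (A : 'M[F]_n.+1).
Hypotheses (two_neq0 : 2%:R != 0 :> F) (symA : A^T = A) (unitA : A \in unitmx).

Local Notation V := 'cV[F]_n.+1.
Local Notation GL := {'GL_n.+1[F]}.
Local Notation B := (bil A).
Local Notation Q x := (bil A x x).
Local Notation O := (form_isometries A).
Local Notation r := (refl A).
Local Notation q := #|F|.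
Local Notation N := (#|F| ^ n.+1)%N.
Implicit Types (x y u v w a b : V) (c k e d : F) (g h t : GL) (C : nat).

(** The approximation with [M = 2]: every value is taken at least half as often as on average. *)
Lemma eigen_level_lower t e c : t \in O -> (t * t = 1)%g -> e ^+ 2 = 1 ->
    (q ^ 2 * 4 <= #|eigen t e|)%N ->
  (#|eigen t e| <= 2 * q * #|level A (eigen t e) c|)%N.
Proof.
move=> tO tt ee big.
have := @eigen_level_approx _ _ _ two_neq0 symA unitA rat 2 t e c tO tt ee big.
rewrite -(ler_nat rat) !natrM; set x := q%:R * #|level _ _ _|%:R; set y := #|eigen t e|%:R => h.
have := ler_norm (y - x); rewrite distrC => h'.
by rewrite -mulrA -/x; lra.
Qed.

(** Multiplying by [r a] enlarges the (-1)-eigenspace by the line of [a] only: [f] splits a vector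
    into its coefficient along [a] and its component orthogonal to [a], which [t] negates. *)
Lemma card_eigen_refl t a : t \in O -> Q a = 1 -> a \in eigen t 1 ->
  (#|eigen (t * r a)%g (-1)| <= q * #|eigen t (-1)|)%N.
Proof.
move=> tO Qa ae; pose f x := (B a x, x - B a x *: a).
have f_inj : injective f.
  by move=> x y [axy]; rewrite axy => /addIr.
rewrite -(card_imset _ f_inj) -[q in (q * _)%N]cardsT -cardsX subset_leq_card //.
apply/subsetP => _ /imsetP[x /eigenP tx ->]; rewrite in_setX in_setT /=.
have Qa0 : Q a != 0 by rewrite Qa oner_neq0.
apply/eigenP; rewrite -{1}[x - _](@refl_fix _ _ A symA a); last first.
  by rewrite !(bilE symA) Qa mulr1 subrr.
rewrite !mulmxBr -!scalemxAr refl_self // mulmxN (eigenP _ _ _ ae) scale1r.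
by rewrite -GL_actM tx !scaleN1r opprB scalerN opprK addrC.
Qed.

Definition small_minus d C : {set GL} :=
  [set t in involutions A d | (#|eigen t (-1)| < C)%N].

Arguments small_minus d%_R C%_N.

Lemma small_minusP d C t :
  reflect (t \in involutions A d /\ (#|eigen t (-1)| < C)%N) (t \in small_minus d C).
Proof. by rewrite [t \in small_minus _ _]in_set; apply: andP. Qed.

(* Double counting of the pairs [(t, a)] with [a] a unit vector of the
   (+1)-eigenspace of [t]: passing to [t * r a] moves [a] to the other side. *)
Lemma card_small_minus_step d C : (4 * q ^ 2 * C <= N)%N ->
  (#|small_minus d C| * N <= #|small_minus (- d) (q * C)| * (2 * q ^ 2 * C ^ 2))%N.
Proof.
move=> bigN.
pose S1 := [set p : GL * V | (p.1 \in small_minus d C) &&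
                             (p.2 \in level A (eigen p.1 1) 1)].
pose S2 := [set p : GL * V | (p.1 \in small_minus (- d) (q * C)) &&
                             (p.2 \in eigen p.1 (-1))].
pose f (p : GL * V) := ((p.1 * r p.2)%g, p.2).
have f_inj : injective f.
  move=> [t a] [t' a'] E; have aE : a = a' := congr1 snd E.
  have tE : (t * r a = t' * r a')%g := congr1 fst E; rewrite -aE in tE *.
  have rr := refl_mulgg symA a.
  by rewrite -(mulgK_involution t rr) tE (mulgK_involution t' rr).
have S12 : (#|S1| <= #|S2|)%N.
  rewrite -(card_imset _ f_inj) subset_leq_card //.
  apply/subsetP => _ /imsetP[[t a] + ->]; rewrite [_ \in S1]in_set /=.
  case/andP=> /small_minusP[/involutionsP[tO tt dt] tC].
  rewrite inE => /andP[ae /eqP Qa].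
  have Qa0 : Q a != 0 by rewrite Qa oner_neq0.
  have aO := refl_isometry symA a.
  rewrite [_ \in S2]in_set /=; apply/andP; split.
    apply/small_minusP; split.
      apply/involutionsP; split; first exact: form_isometriesM.
        exact (mul_refl_involution two_neq0 symA tO tt (oner_neq0 F) ae).
      by rewrite GL_MxE det_mulmx det_refl // dt mulrN1.
    apply: leq_ltn_trans (card_eigen_refl tO Qa ae) _.
    by rewrite ltn_pmul2l // (cardD1 0).
  by apply/eigenP; rewrite GL_actM refl_self // mulmxN (eigenP _ _ _ ae) scale1r scaleN1r.
have S2_le : (#|S2| <= #|small_minus (- d) (q * C)| * (q * C))%N.
  rewrite (card_dep_pairs _ (fun t => eigen t (-1))) -sum_nat_const leq_sum // => t.
  by case/small_minusP=> _ /ltnW.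
(* The cardinals of the two eigenspaces have product [N], so the (+1)-eigenspace has at least
   [N / C] elements, of which a proportion at least [1 / (2 * q)] are unit vectors. *)
have S1_ge : (#|small_minus d C| * N <= 2 * q * C * #|S1|)%N.
  rewrite (card_dep_pairs _ (fun t => level A (eigen t 1) 1)) big_distrr.
  rewrite -sum_nat_const leq_sum //= => t.
  case/small_minusP=> /involutionsP[tO tt _] tC.
  have C0 : (0 < C)%N by apply: leq_trans tC.
  have NE := card_eigen two_neq0 tt.
  have big1 : (N <= #|eigen t 1| * C)%N by rewrite -NE leq_mul2l ltnW ?orbT.
  have big : (q ^ 2 * 4 <= #|eigen t 1|)%N.
    by rewrite -(leq_pmul2r C0) (leq_trans _ big1) // [(_ * 4)%N]mulnC.
  have low := eigen_level_lower 1 tO tt (expr1n _ 2) big.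
  rewrite (leq_trans big1) // mulnAC leq_mul2r low orbT //.
apply: leq_trans S1_ge _; apply: leq_trans (leq_mul (leqnn _) S12) _.
apply: leq_trans (leq_mul (leqnn _) S2_le) _.
by rewrite mulnCA leq_mul2l; apply/orP; right; lia.
Qed.

(** Two steps, with [C] and then [q * C], restore the determinant [d] and gain a factor [N ^ 2]; the
    constants multiply to [4 * q ^ 6 * C ^ 4]. *)
Lemma card_small_minus d C : (4 * q ^ 3 * C <= N)%N ->
  (#|small_minus d C| * N ^ 2 <= #|involutions A d| * (4 * q ^ 6 * C ^ 4))%N.
Proof.
move=> bigN; have q0 : (0 < q)%N by rewrite (cardD1 0).
have bigN1 : (4 * q ^ 2 * C <= N)%N.
  by apply: leq_trans bigN; rewrite leq_mul2r leq_mul2l leq_pexp2l ?orbT.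
have bigN2 : (4 * q ^ 2 * (q * C) <= N)%N.
  by apply: leq_trans bigN; rewrite mulnA -(mulnA 4) -expnSr.
have step1 := card_small_minus_step d bigN1.
have := card_small_minus_step (- d) bigN2; rewrite opprK => step2.
rewrite -[(N ^ 2)%N]mulnn mulnA.
apply: leq_trans (leq_mul step1 (leqnn _)) _; rewrite mulnAC.
apply: leq_trans (leq_mul step2 (leqnn _)) _; rewrite -mulnA.
have sub : (#|small_minus d (q * (q * C))| <= #|involutions A d|)%N.
  by rewrite subset_leq_card //; apply/subsetP => t /small_minusP[].
apply: leq_trans (leq_mul sub (leqnn _)) _.
rewrite leq_mul2l; apply/orP; right; rewrite !expnMn.
by rewrite -!mulnA; nia.
Qed.

(** Negation exchanges the two eigenspaces of an involution, which reduces small (+1)-eigenspaces to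
    small (-1)-eigenspaces. *)
Definition oppGL t : GL := insubd (1%g : GL) (- GLval t).

Lemma val_oppGL t : GLval (oppGL t) = - GLval t.
Proof. by apply: insubdK; rewrite unitrN GL_unit. Qed.

Lemma oppGLK : involutive oppGL.
Proof.
move=> t; apply: val_inj; rewrite -[LHS]/(GLval _) -[RHS]/(GLval _).
by rewrite !val_oppGL opprK.
Qed.

Lemma eigen_oppGL t e : eigen (oppGL t) e = eigen t (- e).
Proof.
apply/setP => x; apply/eigenP/eigenP; rewrite val_oppGL mulNmx scaleNr.
  by move <-; rewrite opprK.
by move->; rewrite opprK.
Qed.

Lemma oppGL_involutions t d :
  t \in involutions A d -> oppGL t \in involutions A ((-1) ^+ n.+1 * d).
Proof.
case/involutionsP=> tO tt <-; apply/involutionsP; split.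
- rewrite inE; apply/forallP => x; rewrite val_oppGL mulNmx bilNl bilNr // opprK.
  by move: tO; rewrite inE => /forallP.
- apply: val_inj; rewrite [LHS]GL_MxE val_oppGL mulNmx mulmxN opprK.
  exact (congr1 (@GLval _ _) tt).
- by rewrite val_oppGL -scaleN1r detZ.
Qed.

Definition unbalanced C : {set GL} :=
  [set t in involutions A 1 | (#|eigen t (-1)| < C)%N || (#|eigen t 1| < C)%N].

(** Involutions with small (+1)-eigenspace are negatives of elements of [small_minus s C], where [s]
    is the determinant of -1; negation also compares the two sets of involutions. The factor 8 is
    twice the 4 of [card_small_minus]. *)
Lemma card_unbalanced C : (4 * q ^ 3 * C <= N)%N ->
  (#|unbalanced C| * N ^ 2 <= #|involutions A 1| * (8 * q ^ 6 * C ^ 4))%N.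
Proof.
move=> bigN; pose s : F := (-1) ^+ n.+1.
have ss : s * s = 1 by rewrite -expr2 -exprM mulnC exprM sqrrN expr1n expr1n.
have le_inv : (#|involutions A s| <= #|involutions A 1|)%N.
  rewrite -(card_imset _ (inv_inj oppGLK)) subset_leq_card //.
  by apply/subsetP => _ /imsetP[t /oppGL_involutions + ->]; rewrite ss.
have sub : unbalanced C \subset small_minus 1 C :|: [set oppGL t | t in small_minus s C].
  apply/subsetP => t; rewrite [_ \in unbalanced _]in_set in_setU.
  case/andP=> tI /orP[tC|tC]; apply/orP; [left|right].
    by apply/small_minusP.
  apply/imsetP; exists (oppGL t); last by rewrite oppGLK.
  apply/small_minusP; split; last by rewrite eigen_oppGL opprK.
  by have := oppGL_involutions tI; rewrite mulr1.
have := subset_leq_card sub; rewrite cardsU => /leq_trans/(_ (leq_subr _ _)).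
rewrite card_imset; last exact: inv_inj oppGLK.
move=> le_card; apply: leq_trans (leq_mul le_card (leqnn _)) _; rewrite mulnDl.
have h1 := card_small_minus 1 bigN; have h2 := card_small_minus s bigN.
have h3 := leq_trans h2 (leq_mul le_inv (leqnn _)).
by apply: leq_trans (leq_add h1 h3) _; rewrite -mulnDr leq_mul2l; apply/orP; right; lia.
Qed.

End SmallEigenspaces.

(** * The matrix of the quadratic form *)

Section StandardForm.

Variables (F : finFieldType) (n : nat).
Hypothesis two_neq0 : 2%:R != 0 :> F.
Local Notation V := 'cV[F]_n.+1.
Implicit Types (x y : V) (alpha beta : F) (k j : nat).

(** A common shape for all four cases: [k] hyperbolic planes and two diagonal terms in the last
    coordinates, whose coefficients may be 0. *)
Definition std_form k alpha beta x : F :=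
  \sum_(i < k) x (inord i.*2) 0 * x (inord i.*2.+1) 0
  + alpha * x (inord n.-1) 0 ^+ 2 + beta * x (inord n) 0 ^+ 2.

Definition std_bil k alpha beta x y : F :=
  \sum_(i < k) (x (inord i.*2) 0 * y (inord i.*2.+1) 0
                + y (inord i.*2) 0 * x (inord i.*2.+1) 0)
  + 2%:R * alpha * (x (inord n.-1) 0 * y (inord n.-1) 0)
  + 2%:R * beta * (x (inord n) 0 * y (inord n) 0).

(** The side conditions say that the hyperbolic planes and the diagonal terms with nonzero
    coefficient occupy disjoint coordinates and together cover all of them; nondegeneracy rests on
    this. *)
Lemma quad_formE (delta : F) (s : orth_sign) : delta != 0 ->
  exists k alpha beta,
    [/\ forall x : V, quad_form delta s x = std_form k alpha beta x,
        (k.*2 <= n.+1)%N, alpha != 0 -> (k.*2 <= n.-1 < n)%N, beta != 0 -> (k.*2 <= n)%N &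
        forall j, (j <= n)%N ->
          [\/ (j < k.*2)%N, j = n.-1 /\ alpha != 0 | j = n /\ beta != 0]].
Proof.
move=> d0; rewrite /quad_form /std_form; case: (boolP (odd n.+1)) => n_odd.
  exists (n.+1)./2, 0, (if s is Plus then 1 else delta).
  have nE : (n.+1./2.*2 = n)%N by move: (odd_double_half n.+1); rewrite n_odd => -[].
  have b0 : (if s is Plus then 1 else delta) != 0 by case: s; rewrite ?oner_neq0.
  split=> [x||||j]; rewrite ?eqxx ?nE //.
    by case: s b0 => _; rewrite mul0r addr0 ?mul1r.
  by rewrite leq_eqVlt => /orP[/eqP->|jn]; [apply: Or33 | apply: Or31].
have nE : (n.+1./2.*2 = n.+1)%N by rewrite -[RHS]odd_double_half (negPf n_odd).
case: s; last first.
  exists (n.+1./2.-1), 1, (- delta).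
  have n0 : (n.-1.+1 = n)%N by case: (n) n_odd.
  have kE : (n.+1./2.-1.*2 = n.-1)%N by rewrite -subn1 doubleB nE subSS subn1.
  split=> [x||||j]; rewrite ?kE.
  - by rewrite mul1r mulNr addrA.
  - by rewrite (leq_trans (leq_pred n)).
  - by rewrite -[X in (_ < X)%N]n0 ltnS !leqnn.
  - by rewrite leq_pred.
  rewrite leq_eqVlt => /orP[/eqP->|jn]; first by apply: Or33; rewrite oppr_eq0.
  move: jn; rewrite -[X in (_ < X)%N]n0 ltnS leq_eqVlt => /orP[/eqP->|jn].
    by apply: Or32; rewrite oner_neq0.
  exact: Or31.
exists (n.+1./2), 0, 0; split=> [x||||j]; rewrite ?eqxx ?nE //.
  by rewrite !mul0r !addr0.
exact: Or31.
Qed.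

Lemma std_form_polar k alpha beta x y :
  std_form k alpha beta (x + y) =
  std_form k alpha beta x + std_form k alpha beta y + std_bil k alpha beta x y.
Proof.
rewrite /std_form /std_bil; set S1 := \sum_(i < k) _; set S2 := \sum_(i < k) _.
set S3 := \sum_(i < k) _; set S4 := \sum_(i < k) _.
have -> : S1 = S2 + S3 + S4.
  rewrite -!big_split; apply: eq_bigr => i _ /=; rewrite !mxE; ring.
by rewrite !mxE; ring.
Qed.

(** Pairing with basis vectors isolates the coordinates of [x]: a hyperbolic one is detected by its
    partner, a diagonal one by its own basis vector, up to the factor [2 * alpha] or [2 * beta]. *)
Lemma std_bil_nondegenerate k alpha beta x :
    (alpha != 0 -> (k.*2 <= n.-1 < n)%N) -> (beta != 0 -> (k.*2 <= n)%N) ->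
    (k.*2 <= n.+1)%N ->
    (forall j, (j <= n)%N ->
       [\/ (j < k.*2)%N, j = n.-1 /\ alpha != 0 | j = n /\ beta != 0]) ->
    (forall y, std_bil k alpha beta x y = 0) ->
  x = 0.
Proof.
move=> ha hb hk cover x0.
pose e j : V := delta_mx (inord j) 0.
have eE i j : (i <= n)%N -> (j <= n)%N -> e j (inord i) 0 = (i == j)%:R.
  move=> i_n j_n; rewrite mxE eqxx andbT; congr (_%:R : F); congr nat_of_bool.
  by rewrite -(inj_eq val_inj) /= !inordK.
have lt1 (i : 'I_k) : (i.*2.+1 <= n)%N.
  by rewrite -ltnS (leq_trans _ hk) // -doubleS leq_double.
have lt0 (i : 'I_k) : (i.*2 <= n)%N by rewrite ltnW.
have tail_a j : (j < k.*2)%N -> alpha * e j (inord n.-1) 0 = 0.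
  move=> jk; have [->|/ha/andP[kn _]] := eqVneq alpha 0; first by rewrite mul0r.
  rewrite eE ?leq_pred ?(leq_trans (ltnW jk)) ?(leq_trans kn) ?leq_pred //.
  by rewrite gtn_eqF ?mulr0 // (leq_trans jk).
have tail_b j : (j < k.*2)%N -> beta * e j (inord n) 0 = 0.
  move=> jk; have [->|/hb kn] := eqVneq beta 0; first by rewrite mul0r.
  by rewrite eE ?(leq_trans (ltnW jk)) // gtn_eqF ?mulr0 // (leq_trans jk).
have hyp_tail j : (k.*2 <= j)%N -> (j <= n)%N ->
    \sum_(i < k) (x (inord i.*2) 0 * e j (inord i.*2.+1) 0
                + e j (inord i.*2) 0 * x (inord i.*2.+1) 0) = 0.
  move=> kj jn; rewrite big1 // => i _; rewrite !eE //.
  have lti : (i.*2.+1 < k.*2)%N by rewrite -doubleS leq_double.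
  by rewrite !ltn_eqF ?mulr0 ?mul0r ?addr0 // ?(leq_trans lti) // (leq_trans (ltnW lti)).
have coef j : (j <= n)%N -> x (inord j) 0 = 0.
  move=> jn; case: (cover j jn) => [jk|[jE a0]|[jE b0]].
  - have [i ji] : exists i : 'I_k, (j = odd j + i.*2)%N.
      have jk2 : (j./2 < k)%N.
        rewrite -ltn_double (leq_ltn_trans _ jk) //.
        by rewrite -[X in (_ <= X)%N]odd_double_half leq_addl.
      by exists (Ordinal jk2); rewrite odd_double_half.
    (* The other index of the hyperbolic pair that contains [j]. *)
    pose j' := (~~ odd j + i.*2)%N.
    have j'k : (j' < k.*2)%N.
      by apply: (@leq_trans i.+1.*2); rewrite ?leq_double // doubleS /j'; case: (odd j).
    have j'n : (j' <= n)%N by rewrite -ltnS (leq_trans j'k).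
    have := x0 (e j'); rewrite /std_bil.
    have -> : 2%:R * alpha * (x (inord n.-1) 0 * e j' (inord n.-1) 0) = 0.
      by rewrite mulrCA -!mulrA tail_a // !mulr0.
    have -> : 2%:R * beta * (x (inord n) 0 * e j' (inord n) 0) = 0.
      by rewrite mulrCA -!mulrA tail_b // !mulr0.
    rewrite !addr0 (bigD1 i) //= big1 ?addr0 => [|i' i'i]; last first.
      have neq (b b' : bool) : (b + i'.*2 == b' + i.*2)%N = (b == b') && (i' == i).
        apply/eqP/andP => [E|[/eqP-> /eqP->] //].
        have := congr1 odd E; have := congr1 half E.
        by rewrite !half_bit_double !oddD !odd_double !addbF !oddb => /val_inj-> ->.
      have n1 : (i'.*2.+1 == j')%N = false.
        by have := neq true (~~ odd j); rewrite (negPf i'i) andbF.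
      have n2 : (i'.*2 == j')%N = false.
        by have := neq false (~~ odd j); rewrite (negPf i'i) andbF.
      by rewrite !eE // n1 n2 mulr0 mul0r addr0.
    rewrite !eE // /j'; case: (odd j) ji => /= ->.
      by rewrite !add0n eqxx gtn_eqF // mulr0 mul1r add0r.
    by rewrite eqxx ltn_eqF // mul0r mulr1 addr0.
  - have /andP[ka na] := ha a0; have nn : (n.-1 <= n)%N by apply: leq_pred.
    have := x0 (e j); rewrite /std_bil hyp_tail ?jE // add0r !eE // eqxx mulr1.
    rewrite gtn_eqF // !mulr0 addr0 => /eqP.
    by rewrite !mulf_eq0 (negPf two_neq0) (negPf a0) => /eqP.
  have kn := hb b0.
  have := x0 (e j); rewrite /std_bil hyp_tail ?jE // add0r !eE ?leq_pred // eqxx mulr1.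
  have alpha0 : alpha * (x (inord n.-1) 0 * (n.-1 == n)%:R) = 0.
    have [->|/ha/andP[_ na]] := eqVneq alpha 0; first by rewrite mul0r.
    by rewrite ltn_eqF // !mulr0.
  rewrite -mulrA alpha0 mulr0 add0r => /eqP.
  by rewrite !mulf_eq0 (negPf two_neq0) (negPf b0) => /eqP.
by apply/colP => i; rewrite [RHS]mxE -(inord_val i) coef // -ltnS ltn_ord.
Qed.

Lemma delta_mx_form (i j : 'I_n.+1) x : (x^T *m delta_mx i j *m x) 0 0 = x i 0 * x j 0.
Proof.
rewrite -(mul_delta_mx (0 : 'I_1)) mulmxA -mulmxA [LHS]mxE big_ord1.
by rewrite -colE -rowE !mxE.
Qed.

Lemma std_form_mx k alpha beta :
  exists M : 'M[F]_n.+1, forall x, std_form k alpha beta x = (x^T *m M *m x) 0 0.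
Proof.
exists (\sum_(i < k) delta_mx (inord i.*2) (inord i.*2.+1)
        + alpha *: delta_mx (inord n.-1) (inord n.-1)
        + beta *: delta_mx (inord n) (inord n)) => x.
rewrite !mulmxDr !mulmxDl mulmx_sumr mulmx_suml -!scalemxAr -!scalemxAl.
rewrite ![(_ + _ : 'M_1) 0 0]mxE summxE ![(_ *: _ : 'M_1) 0 0]mxE !delta_mx_form.
rewrite -!expr2 /std_form; congr (_ + _ + _).
by apply: eq_bigr => i _; rewrite delta_mx_form.
Qed.

Lemma quad_form_bil (delta : F) (s : orth_sign) : delta != 0 ->
  exists A : 'M[F]_n.+1, [/\ A^T = A, A \in unitmx &
    forall x, quad_form delta s x = bil A x x].
Proof.
move=> d0; have [k [alpha [beta [qE hk ha hb cover]]]] := quad_formE s d0.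
have [M ME] := std_form_mx k alpha beta.
(* Halving makes [bil A x x] equal to the quadratic form; the polar form is then twice [bil A]. *)
pose A := 2%:R^-1 *: (M + M^T).
have symA : A^T = A by rewrite /A linearZ linearD /= trmxK addrC.
have AE x : std_form k alpha beta x = bil A x x.
  rewrite /bil /A -scalemxAr -scalemxAl mxE mulmxDr mulmxDl mxE -ME.
  have -> : (x^T *m M^T *m x) 0 0 = std_form k alpha beta x.
    by rewrite ME -[in RHS](trmxK (x^T *m M *m x)) [RHS]mxE !trmx_mul trmxK mulmxA.
  by field.
exists A; split=> // [|x]; last by rewrite qE AE.
rewrite -row_free_unit -kermx_eq0; apply/eqP/row_matrixP => i.
set v := row i _; have vA : v *m A = 0 by rewrite -row_mul mulmx_ker row0.
rewrite row0 -[v]trmxK [v^T](std_bil_nondegenerate ha hb hk cover) ?trmx0 // => y.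
have := std_form_polar k alpha beta v^T y; rewrite !AE !(bilE symA).
have -> : bil A y v^T = bil A v^T y by rewrite bilC.
have -> : bil A v^T y = 0 by rewrite /bil trmxK vA mul0mx mxE.
by rewrite !addr0 add0r => /eqP; rewrite eq_sym -subr_eq0 addrAC subrr add0r => /eqP.
Qed.

End StandardForm.

(** * The mean of the character *)

(** Expand the error as [(x - u) * (y - v) + u * (y - v) + v * (x - u)]: each term is at most
    [u * v / M], the first one because [M] is at least 1. *)
Lemma approx_mul (R : realFieldType) (M u v x y : R) :
    1 <= M -> 0 <= u -> 0 <= v -> M * `|x - u| <= u -> M * `|y - v| <= v ->
  M * `|x * y - u * v| <= 3%:R * (u * v).
Proof.
move=> M1 u0 v0 xu yv.
have -> : x * y - u * v = (x - u) * (y - v) + (u * (y - v) + v * (x - u)) by ring.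
have M0 : 0 <= M by apply: le_trans M1.
have yv' : `|y - v| <= v by apply: le_trans yv; rewrite ler_peMl.
apply: le_trans (ler_wpM2l M0 (le_trans (ler_normD _ _) (lerD (lexx _) (ler_normD _ _)))) _.
rewrite !normrM (ger0_norm u0) (ger0_norm v0) !mulrDr.
have h1 : M * (`|x - u| * `|y - v|) <= u * v.
  by rewrite mulrA; apply: ler_pM => //; rewrite mulr_ge0.
have h2 : M * (u * `|y - v|) <= u * v by rewrite mulrCA ler_wpM2l.
have h3 : M * (v * `|x - u|) <= u * v by rewrite mulrCA [u * v]mulrC ler_wpM2l.
lra.
Qed.

Section SpinEquidistribution.

Variables (F : finFieldType) (n : nat) (A : 'M[F]_n.+1) (delta : F).
Hypotheses (two_neq0 : 2%:R != 0 :> F) (symA : A^T = A) (unitA : A \in unitmx).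
Hypothesis delta_nonsquare : forall c : F, c ^+ 2 != delta.
Variables (R : realFieldType) (M : nat).
Hypothesis M_gt0 : (0 < M)%N.

Local Notation q := #|F|.
Local Notation N := (#|F| ^ n.+1)%N.
Local Notation C := (#|F| ^ 2 * M ^ 2)%N.
Local Notation I := (involutions A 1).

(** The threshold [C] is the one of [level_approx]. Each of the two products in [card_balanced]
    contributes an error [3 * N / M]. *)
Lemma balanced_approx t : t \in I -> t \notin unbalanced A C ->
  M%:R * `|q%:R ^+ 2 * #|balanced A delta t|%:R - 2%:R * N%:R| <= 6%:R * N%:R :> R.
Proof.
move=> tI; rewrite [_ \in unbalanced _ _]in_set tI negb_or -!leqNgt => /andP[minus_C plus_C].
have [tO tt _] := involutionsP _ _ _ tI.
have N1s : (-1) ^+ 2 = 1 :> F by rewrite sqrrN expr1n.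
have plus c := @eigen_level_approx _ _ _ two_neq0 symA unitA R M t 1 c tO tt (expr1n _ 2) plus_C.
have minus c := @eigen_level_approx _ _ _ two_neq0 symA unitA R M t (-1) c tO tt N1s minus_C.
rewrite (card_balanced A delta_nonsquare) -(card_eigen two_neq0 tt) natrD !natrM.
set u : R := #|eigen t 1|%:R; set v : R := #|eigen t (-1)|%:R.
have M1 : 1 <= M%:R :> R by rewrite ler1n.
have [u0 v0] : 0 <= u /\ 0 <= v by rewrite !ler0n.
have h1 := approx_mul M1 u0 v0 (plus 1) (minus delta).
have h2 := approx_mul M1 u0 v0 (plus delta) (minus 1).
set x1 : R := #|level A (eigen t 1) 1|%:R in h1 h2 *.
set y1 : R := #|level A (eigen t 1) delta|%:R in h1 h2 *.
set x2 : R := #|level A (eigen t (-1)) 1|%:R in h1 h2 *.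
set y2 : R := #|level A (eigen t (-1)) delta|%:R in h1 h2 *.
have -> : q%:R ^+ 2 * (x1 * y2 + y1 * x2) - 2%:R * (u * v) =
    (q%:R * x1 * (q%:R * y2) - u * v) + (q%:R * y1 * (q%:R * x2) - u * v) by ring.
apply: le_trans (ler_wpM2l (ler0n _ M) (ler_normD _ _)) _.
rewrite mulrDr; apply: le_trans (lerD h1 h2) _; lra.
Qed.

(** Serves for the unbalanced [t], which are rare: both terms lie between 0 and the bound. *)
Lemma balanced_crude t : t \in I ->
  `|q%:R ^+ 2 * #|balanced A delta t|%:R - 2%:R * N%:R| <= 2%:R * q%:R ^+ 2 * N%:R :> R.
Proof.
case/involutionsP=> tO tt _.
have sub e c : (#|level A (eigen t e) c| <= #|eigen t e|)%N.
  by rewrite subset_leq_card //; apply/subsetP => x; rewrite inE => /andP[].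
have le_N : (#|balanced A delta t| <= 2 * N)%N.
  rewrite (card_balanced A delta_nonsquare) -(card_eigen two_neq0 tt) mul2n -addnn.
  by apply: leq_add; apply: leq_mul.
have q1 : 1 <= q%:R ^+ 2 :> R by rewrite -natrX ler1n expn_gt0 (cardD1 0).
have := le_N; rewrite -(ler_nat R) natrM.
set f : R := #|balanced _ _ _|%:R; set m : R := N%:R => f_le.
have f0 : 0 <= f by apply: ler0n.
have m0 : 0 <= m by apply: ler0n.
set Q2 := q%:R ^+ 2 in q1 *.
have h1 : Q2 * f <= Q2 * (2%:R * m) by rewrite ler_wpM2l // (le_trans _ q1).
have h2 : 0 <= Q2 * f by rewrite mulr_ge0 // (le_trans _ q1).
have h3 : 1 * m <= Q2 * m by rewrite ler_wpM2r.
rewrite ler_norml; apply/andP; split; lra.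
Qed.

(** Subtracting [q ^ 2] times the vanishing sum of [sum_spin_balanced] from [2 * N * S] weights each
    character value by [2 * N - q ^ 2 * f t]. This is small for balanced [t]; the others are
    controlled by [card_unbalanced]. *)
Lemma spin_sum_bound : (4 * q ^ 3 * C <= N)%N ->
  `|\sum_(t in I) (-1) ^+ spin A t|
    <= (3%:R / M%:R + 8%:R * q%:R ^+ 8 * C%:R ^+ 4 / N%:R ^+ 2) * #|I|%:R :> R.
Proof.
move=> bigN; set S : R := \sum_(t in I) _.
have M0 : 0 < M%:R :> R by rewrite ltr0n.
have N0 : 0 < N%:R :> R by rewrite ltr0n expn_gt0 (cardD1 0).
set f : {'GL_n.+1[F]} -> R := fun t => #|balanced A delta t|%:R.
have factor (m c Q2 b : R) : m * c - Q2 * (c * b) = c * (m - Q2 * b) by ring.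
have S2N : 2%:R * N%:R * S =
    \sum_(t in I) (-1) ^+ spin A t * (2%:R * N%:R - q%:R ^+ 2 * f t).
  have S0 := sum_spin_balanced two_neq0 symA delta_nonsquare R.
  transitivity (2%:R * N%:R * S -
      q%:R ^+ 2 * \sum_(t in I) (-1) ^+ spin A t * f t).
    by rewrite S0 mulr0 subr0.
  by rewrite /S !mulr_sumr -sumrB; apply: eq_bigr => t _; apply: factor.
have term t : t \in I -> `|(-1) ^+ spin A t * (2%:R * N%:R - q%:R ^+ 2 * f t)| <=
    6%:R * N%:R / M%:R + 2%:R * q%:R ^+ 2 * N%:R * (t \in unbalanced A C)%:R.
  move=> tI; rewrite normrM normrX normrN1 expr1n mul1r distrC.
  have [tb|tb] := boolP (t \in unbalanced A C); last first.
    rewrite mulr0 addr0 ler_pdivlMr // mulrC; exact: balanced_approx.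
  rewrite mulr1; apply: le_trans (balanced_crude tI) _.
  by rewrite lerDr divr_ge0 ?mulr_ge0 ?ler0n.
have sum_term : 2%:R * N%:R * `|S| <=
    6%:R * N%:R / M%:R * #|I|%:R + 2%:R * q%:R ^+ 2 * N%:R * #|unbalanced A C|%:R.
  rewrite -[2%:R * N%:R]ger0_norm ?mulr_ge0 ?ler0n // -normrM S2N.
  apply: le_trans (ler_norm_sum _ _ _) _; apply: le_trans (ler_sum _ term) _.
  rewrite big_split /= sumr_const -[_ *+ #|I|]mulr_natr lerD2l -mulr_sumr.
  rewrite ler_wpM2l ?mulr_ge0 ?exprn_ge0 ?ler0n // -natr_sum ler_nat.
  have -> : (\sum_(t in I) (t \in unbalanced A C) =
             \sum_(t in I | t \in unbalanced A C) 1)%N.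
    by rewrite big_mkcondr; apply: eq_bigr => t _; case: (t \in unbalanced A C).
  rewrite sum1dep_card subset_leq_card //; apply/subsetP => t.
  by rewrite [t \in [set _ | _]]in_set => /andP[].
have bad : #|unbalanced A C|%:R <= #|I|%:R * (8%:R * q%:R ^+ 6 * C%:R ^+ 4) / N%:R ^+ 2 :> R.
  rewrite ler_pdivlMr ?exprn_gt0 // -!natrX -!natrM ler_nat.
  exact: card_unbalanced.
have {}sum_term : `|S| <= 3%:R / M%:R * #|I|%:R + q%:R ^+ 2 * #|unbalanced A C|%:R.
  rewrite -(ler_pM2l (_ : 0 < 2%:R * N%:R)); last by rewrite mulr_gt0.
  apply: le_trans sum_term _; rewrite le_eqVlt; apply/orP; left; apply/eqP.
  by field; rewrite lt0r_neq0.
apply: le_trans sum_term _; rewrite [leRHS]mulrDl lerD2l.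
apply: le_trans (ler_wpM2l (exprn_ge0 2 (ler0n _ _)) bad) _.
by rewrite le_eqVlt; apply/orP; left; apply/eqP; field; rewrite lt0r_neq0.
Qed.

Lemma num_involutionsE :
  num_involutions (special_form_isometries A) = #|I|.
Proof.
apply: eq_card => t; rewrite !in_set -[(t ^+ 2)%g]/(t * t)%g -andbA.
by congr (_ && _); apply: andbC.
Qed.

Lemma num_involutions_derived : (1 < n)%N ->
  num_involutions (special_form_isometries_group A)^`(1)%g =
  #|[set t in I | ~~ spin A t]|.
Proof.
move=> n1; apply: eq_card => t; rewrite [LHS]in_set [RHS]in_set.
apply/andP/andP => [[tD /eqP tt]|[/involutionsP[tO tt dt] ts]].
  have tSO : t \in special_form_isometries A := subsetP (der_sub 1 _) t tD.
  have tt' : (t * t = 1)%g := tt.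
  have := tSO; rewrite {1}[_ \in special_form_isometries A]in_set => /andP[tO /eqP dt].
  rewrite -(involution_derivedE two_neq0 symA unitA delta_nonsquare n1 tSO tt') tD.
  by split=> //; apply/involutionsP.
have tSO : t \in special_form_isometries A.
  by rewrite in_set dt eqxx andbT.
by rewrite (involution_derivedE two_neq0 symA unitA delta_nonsquare n1 tSO tt)
  -[(t ^+ 2)%g]/(t * t)%g tt.
Qed.

Lemma involution_ratio_bound : (1 < n)%N -> (4 * q ^ 3 * C <= N)%N ->
  `|2^-1 - (num_involutions (special_form_isometries_group A)^`(1)%g)%:R /
           (num_involutions (special_form_isometries A))%:R|
    <= 3%:R / M%:R + 8%:R * q%:R ^+ 8 * C%:R ^+ 4 / N%:R ^+ 2 :> R.
Proof.
move=> n1 bigN; rewrite num_involutionsE num_involutions_derived //.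
have I0 : 0 < #|I|%:R :> R.
  rewrite ltr0n; apply/card_gt0P; exists 1%g; apply/involutionsP.
  by split; [exact: (group1 (form_isometries_group A))|exact: mulg1|rewrite GL_1E det1].
have := spin_sum_bound bigN; set E := _ + _ => bound.
set D := #|[set t in I | _]|.
have DE t : (t \in [set t in I | ~~ spin A t]) = (t \in I) && ~~ spin A t.
  by rewrite [LHS]in_set.
have SE : \sum_(t in I) (-1) ^+ spin A t = 2%:R * D%:R - #|I|%:R :> R.
  rewrite /D -sum1_card natr_sum mulr_sumr -sumr_const big_mkcond /=.
  rewrite [X in _ = _ - X]big_mkcond [X in _ = X - _]big_mkcond -sumrB /=.
  apply: eq_bigr => t _; rewrite DE.
  by case: (t \in I); case: (spin A t); rewrite /= ?expr1 ?expr0 ?mulr1; ring.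
(* The deviation from one half is half the mean of the character, up to sign; the factor one half is
   then given away. *)
have -> : 2^-1 - D%:R / #|I|%:R = - (2%:R * D%:R - #|I|%:R) / (2%:R * #|I|%:R) :> R.
  by field; rewrite lt0r_neq0.
rewrite -SE normrM normrN normfV [X in _ / X]ger0_norm ?mulr_ge0 ?ler0n //.
rewrite ler_pdivrMr ?mulr_gt0 //; apply: le_trans bound _.
rewrite mulrCA -[leLHS]mul1r ler_wpM2r ?ler1n // mulr_ge0 ?ler0n //.
by rewrite addr_ge0 // divr_ge0 ?mulr_ge0 ?exprn_ge0 ?ler0n.
Qed.

End SpinEquidistribution.

(** * Return to the groups of the statement, and the limit *)

Lemma special_orthogonal_setE (F : finFieldType) (delta : F) (s : orth_sign)
    (n : nat) (A : 'M[F]_n.+1) :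
    (forall x, quad_form delta s x = bil A x x) ->
  special_orthogonal_set delta s n = special_form_isometries A.
Proof.
move=> qE; apply/setP => g.
rewrite [LHS]in_set [RHS]in_set; congr (_ && _).
rewrite [LHS]in_set [RHS]in_set; apply: eq_forallb => x.
by rewrite !qE.
Qed.

Local Open Scope classical_set_scope.
Local Open Scope ring_scope.

Theorem corollary7p3 (R : realType) (F : finFieldType) (Fodd : odd #|F|)
    (delta : F) (delta_nonsquare : ~ exists x : F, x ^+ 2 = delta)
    (s : orth_sign) :
  (fun n : nat =>
     (num_involutions (Omega_group delta s n))%:R /
     (num_involutions (special_orthogonal_group delta s n))%:R : R)
    @ \oo --> (2^-1 : R).
Proof.
have two_neq0 := two_neq0_odd_card Fodd.
have nonsquare c : c ^+ 2 != delta.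
  by apply/negP => /eqP cd; apply: delta_nonsquare; exists c.
have d0 := nonsquare_neq0 nonsquare.
have q_gt1 : (1 < #|F|)%N := card_finNzRing_gt1 F.
apply/cvgrPdist_lt => e e0.
(* Chosen so that the error term [3 / M] is below [e / 2]. *)
pose M := Num.bound (6%:R / e).
have M_large : 6%:R / e < M%:R.
  by apply: archi_boundP; rewrite divr_ge0 // ltW.
have M_gt0 : (0 < M)%N.
  by rewrite -(ltr0n R) (le_lt_trans _ M_large) // divr_ge0 // ltW.
pose C := (#|F| ^ 2 * M ^ 2)%N.
pose K : R := 8%:R * #|F|%:R ^+ 8 * C%:R ^+ 4.
have K0 : 0 <= K by rewrite !mulr_ge0 ?exprn_ge0.
(* The summands ensure dimension at least 3, the size condition of [involution_ratio_bound], and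
   [2 * K / e < N]; the last two go through [n <= #|F| ^ n.+1]. *)
pose n0 := (2 + 4 * #|F| ^ 3 * C + Num.bound (2%:R * K / e))%N.
exists n0 => // n /= n0n.
have [A [symA unitA qE]] := @quad_form_bil F n two_neq0 delta s d0.
rewrite (special_orthogonal_setE qE).
have n_gt1 : (1 < n)%N by apply: leq_trans n0n; rewrite /n0 -addnA leq_addr.
have nN : (n <= #|F| ^ n.+1)%N by apply/ltnW/(ltn_trans (ltnSn n)); apply: ltn_expl.
have bigN : (4 * #|F| ^ 3 * C <= #|F| ^ n.+1)%N.
  apply: leq_trans nN; apply: leq_trans n0n.
  by rewrite /n0 addnAC leq_addl.
apply: le_lt_trans
  (involution_ratio_bound two_neq0 symA unitA nonsquare R M_gt0 n_gt1 bigN) _.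
rewrite -/C -/K; set N : R := (#|F| ^ n.+1)%:R.
have N_large : 2%:R * K / e < N.
  apply: (lt_le_trans (archi_boundP _)); first by rewrite divr_ge0 ?mulr_ge0 // ltW.
  by rewrite ler_nat (leq_trans _ nN) // (leq_trans _ n0n) // leq_addl.
have N1 : 1 <= N by rewrite ler1n expn_gt0 ltnW.
have N0 : 0 < N by apply: lt_le_trans N1.
have h1 : 3%:R / M%:R < e / 2%:R.
  by rewrite ltr_pdivrMr // in M_large; rewrite ltr_pdivrMr ?ltr0n //; lra.
have h2 : K / N ^+ 2 < e / 2%:R.
  rewrite ltr_pdivrMr // in N_large; rewrite ltr_pdivrMr ?exprn_gt0 //.
  (* As [N] is at least 1, replacing [N ^+ 2] by [N] only strengthens the bound to be shown. *)
  apply: (@lt_le_trans _ _ (e / 2%:R * N)); first lra.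
  by rewrite ler_wpM2l ?divr_ge0 ?(ltW e0) // expr2 ler_peMr // ltW.
lra.
Qed.
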